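(* Set $c_0=2^{-20}$ and $c=\dfrac{1}{2560\cdot 10^4\cdot 2^{39}}$. Let $\Delta,L,\sigma>0$, let $$0<\varepsilon\le c_0\min\{\sigma,\sqrt{\Delta L}\},$$ and let $N$ be a positive integer with $$N\le c\left(\frac{\Delta L}{\varepsilon^2}+\frac{\Delta L\sigma^2}{\varepsilon^4}\right).$$ Then there exists a finite dimension $d=d(\Delta,L,\sigma,\varepsilon,N)$, explicitly $$d=T\left\lceil\max\{2^{15},\,256\log(16(N+1)T)\}\right\rceil,\qquad T=\left\lfloor\frac{\Delta L}{320\cdot 10^4\,\varepsilon^2}\right\rfloor,$$ such that the following holds. For every randomized adaptive algorithm on $\mathbb R^d$ making at most $N$ oracle queries, there exist a function $F\in\mathcal F_d(\Delta,L)$ and a fixed-law stochastic first-order oracle for $F$ which is unbiased and has uniformly almost-surely bounded noise of radius $\sigma$, for which the output $\widehat x_N$ of the algorithm satisfies $$\mathbb E_{U,Z_{1:N}}\|\nabla F(\widehat x_N)\|>\varepsilon .$$ In particular, in the regime $0<\varepsilon\le c_0\min\{\sigma,\sqrt{\Delta L}\}$, the dimension-free minimax query complexity is $$\Omega\!\left(\frac{\Delta L}{\varepsilon^2}+\frac{\Delta L\sigma^2}{\varepsilon^4}\right),$$ i.e. at least a universal positive constant times this quantity.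
   Context: $\|\cdot\|$ is the Euclidean norm and $\log$ the natural logarithm. Function class. For $d\in\mathbb N$ and $\Delta,L>0$, $\mathcal F_d(\Delta,L)$ is the set of continuously differentiable functions $F:\mathbb R^d\to\mathbb R$ that are bounded below, satisfy $F(0)-\inf_xF(x)\le\Delta$, and satisfy $\|\nabla F(x)-\nabla F(y)\|\le L\|x-y\|$ for all $x,y$. Oracle. For $F:\mathbb R^d\to\mathbb R$, a (fixed-law) stochastic first-order oracle is a probability space $(\mathcal Z,\mathcal P)$ and a jointly Borel measurable map $g:\mathbb R^d\times\mathcal Z\to\mathbb R^d$ with $\mathbb E_{Z\sim\mathcal P}\,g(x,Z)=\nabla F(x)$ for all $x\in\mathbb R^d$ (unbiasedness). It has uniformly almost-surely bounded noise of radius $\sigma$ if there is one measurable set $\mathcal Z_0\subseteq\mathcal Z$, common to every $x$, with $\mathcal P(\mathcal Z_0)=1$ and $\|g(x,z)-\nabla F(x)\|\le\sigma$ for all $x\in\mathbb R^d$ and $z\in\mathcal Z_0$. Successive queries use fresh independent draws from the same law $\mathcal P$. Algorithm. A randomized adaptive $N$-query algorithm on $\mathbb R^d$ consists of a private random seed $U$, independent of the instance and of the samples, measurable query rules $x_t=X_t(U,Y_1,\dots,Y_{t-1})$ with responses $Y_t=g(x_t,Z_t)$ for $1\le t\le N$, and an arbitrary measurable output rule $\widehat x_N=X_{N+1}(U,Y_1,\dots,Y_N)$, where $Z_1,\dots,Z_N$ are i.i.d. with law $\mathcal P$. There is one query per fresh sample (the algorithm cannot evaluate the same $Z_t$ at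 several points). An algorithm using fewer than $N$ queries may be padded by ignored queries. Minimax complexity. For a dimension-indexed family of algorithms (one algorithm on $\mathbb R^d$ for each $d$), the worst-case expected stationarity risk is the supremum of $\mathbb E\|\nabla F(\widehat x_N)\|$ over all finite dimensions $d$, all $F\in\mathcal F_d(\Delta,L)$, and all fixed-law stochastic first-order oracles $((\mathcal Z,\mathcal P),g)$ for $F$ that are unbiased and have uniformly almost-surely bounded noise of radius $\sigma$. The dimension-free minimax query complexity is the least number of queries $N$ for which some dimension-indexed family of $N$-query algorithms has worst-case expected stationarity risk at most $\varepsilon$. *)

(* Defs.v *)
From HB Require Import structures.
From mathcomp Require Import all_boot all_order all_algebra.
From mathcomp Require Import all_classical all_reals all_analysis.

Set Implicit Arguments.
Unset Strict Implicit.
Unset Printing Implicit Defensive.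

Import Order.TTheory GRing.Theory Num.Theory.
Import numFieldNormedType.Exports.

Local Open Scope classical_set_scope.
Local Open Scope ring_scope.

(* The norm [`|x|] of the library on ['rV_d] is the max norm. *)
Definition enorm (R : realType) (d : nat) (x : 'rV[R]_d) : R :=
  Num.sqrt (\sum_(i < d) x 0 i ^+ 2).

Definition gradient (R : realType) (d : nat) (F : 'rV[R]_d -> R)
    (x : 'rV[R]_d) : 'rV[R]_d :=
  \row_(i < d) 'D_(delta_mx 0 i) F x.

Definition smooth_class (R : realType) (d : nat) (Delta L : R)
    (F : 'rV[R]_d -> R) : Prop :=
  [/\ (forall x, differentiable F x) /\ continuous (gradient F),
      has_lbound (range F),
      F 0 - inf (range F) <= Delta &
      forall x y, enorm (gradient F x - gradient F y) <= L * enorm (x - y)].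

(* R^d with its Borel sigma-algebra: the max norm and the Euclidean norm have
   the same open sets. *)
Definition borel_rV (R : realType) (d : nat) :=
  g_sigma_algebraType (@open 'rV[R]_d).

Record oracle (R : realType) (d : nat) := Oracle {
  oracle_disp : measure_display;
  sample : measurableType oracle_disp;
  sample_law : probability sample R;
  answer : borel_rV R d * sample -> borel_rV R d;
  measurable_answer : measurable_fun [set: borel_rV R d * sample] answer }.
Arguments answer {R d} _.

Definition unbiased (R : realType) (d : nat) (F : 'rV[R]_d -> R)
    (O : oracle R d) : Prop :=
  forall (x : 'rV[R]_d) (i : 'I_d),
    (sample_law O).-integrable [set: sample O]
      (fun z => ((answer O (x, z) : 'rV[R]_d) 0 i)%:E) /\
    ('E_(sample_law O)[fun z => ((answer O (x, z) : 'rV[R]_d) 0 i)%R]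
      = (gradient F x 0%R i)%:E)%E.

Definition bounded_noise (R : realType) (d : nat) (sigma : R)
    (F : 'rV[R]_d -> R) (O : oracle R d) : Prop :=
  exists Z0 : set (sample O),
    [/\ measurable Z0, sample_law O Z0 = 1%E &
        forall (x : 'rV[R]_d) (z : sample O), Z0 z ->
          enorm ((answer O (x, z) : 'rV[R]_d) - gradient F x) <= sigma].

(* [query A (u, [tuple Y_1; ..; Y_t])] is the query point x_(t+1); its values
   on t.-tuples with t >= N are never used. *)
Record algorithm (R : realType) (d N : nat) := Algorithm {
  seed_disp : measure_display;
  seed : measurableType seed_disp;
  seed_law : probability seed R;
  query : forall t : nat, seed * t.-tuple (borel_rV R d) -> borel_rV R d;
  output : seed * N.-tuple (borel_rV R d) -> borel_rV R d;
  measurable_query : forall t : nat, (t < N)%N ->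
    measurable_fun [set: seed * t.-tuple (borel_rV R d)] (@query t);
  measurable_output :
    measurable_fun [set: seed * N.-tuple (borel_rV R d)] output }.
Arguments query {R d N} _ {t}.
Arguments output {R d N} _.

Section iid.
Context {disp : measure_display} {T : measurableType disp}.

Definition tsnoc (n : nat) (p : n.-tuple T * T) : n.+1.-tuple T :=
  [tuple of rcons p.1 p.2].

Lemma measurable_tsnoc (n : nat) :
  measurable_fun [set: n.-tuple T * T] (@tsnoc n).
Proof.
apply/measurable_fun_tnthP => i.
case: (unliftP ord_max i) => [j|] ->.
  rewrite (_ : _ \o _ = (fun t => tnth t j) \o fst).
    by apply: measurableT_comp => //; exact: measurable_tnth.
  apply/funext => -[t x] /=.
  by rewrite !(tnth_nth x) lift_max nth_rcons size_tuple ltn_ord.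
rewrite (_ : _ \o _ = snd) //.
apply/funext => -[t x] /=.
by rewrite (tnth_nth x) /= nth_rcons size_tuple ltnn eqxx.
Qed.

HB.instance Definition _ (n : nat) :=
  isMeasurableFun.Build _ _ _ _ (@tsnoc n) (@measurable_tsnoc n).

Fixpoint iid_law (R : realType) (P : probability T R) (n : nat) :
    probability (n.-tuple T) R :=
  match n with
  | 0 => \d_ [tuple]
  | m.+1 => distribution (iid_law P m \x P)%E (@tsnoc m)
  end.

End iid.

Section run.
Context {R : realType} {d N : nat} (A : algorithm R d N) (O : oracle R d).

Fixpoint responses (u : seed A) (t : nat) :
    t.-tuple (sample O) -> t.-tuple (borel_rV R d) :=
  match t with
  | 0 => fun _ => [tuple]
  | s.+1 => fun z =>
      let ys := responses u [tuple tnth z (widen_ord (leqnSn s) i) | i < s] in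
      [tuple of rcons ys (answer O (query A (u, ys), tnth z ord_max))]
  end.

Definition final_point (w : seed A * N.-tuple (sample O)) : 'rV[R]_d :=
  output A (w.1, responses w.1 w.2).

Definition stationarity_risk (F : 'rV[R]_d -> R) : \bar R :=
  ('E_(seed_law A \x iid_law (sample_law O) N)
     [fun w => enorm (gradient F (final_point w))])%E.

End run.

Definition worst_case_risk (R : realType) (Delta L sigma : R) (N : nat)
    (A : forall d : nat, algorithm R d N) : \bar R :=
  ereal_sup [set r | exists (d : nat) (F : 'rV[R]_d -> R) (O : oracle R d),
    [/\ smooth_class Delta L F, unbiased F O, bounded_noise sigma F O &
        r = stationarity_risk (A d) O F]].

(* [+oo] when no number of queries suffices. *)
Definition minimax_complexity (R : realType) (Delta L sigma eps : R) : \bar R :=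
  ereal_inf [set N%:R%:E | N in [set N : nat |
    exists A : forall d : nat, algorithm R d N,
      (worst_case_risk Delta L sigma A <= eps%:E)%E]].

Definition chain_length (R : realType) (Delta L eps : R) : nat :=
  Num.truncn (Delta * L / (320 * 10 ^+ 4 * eps ^+ 2)).

Definition hard_dim (R : realType) (Delta L eps : R) (N : nat) : nat :=
  let T := chain_length Delta L eps in
  let m : R := Num.max (2 ^+ 15) (256 * ln (16 * (N + 1)%:R * T%:R)) in
  (T * `|Num.ceil m|)%N.

(* Main.v *)
(** A chain of [T] blocks of [m] coordinates hides a random sign vector in each
    block.  A block is discovered by a point that correlates with its signs, the
    gradient in a block is informative only once the previous block is discovered,
    and the gradient is large as long as some block is undiscovered.  The oracle
    multiplies the signs of the frontier, the block that follows the last discovered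
    one, by coins of bias [del], of order [eps / sigma], and rescales by [1 / del]:
    the answers are unbiased with noise of order [eps / del], while each of them
    carries an information of order [del ^+ 2] only on each hidden sign.  Hence [K]
    answers, with [K] of order [(sigma / eps) ^+ 2], increase the probability of
    correlating with the [m] hidden signs by a factor [exp (m * K * del ^+ 2)] at
    most, up to constants, and after [N < T * K] queries the last block is still
    undiscovered with high probability.  Averaging over the signs yields a hard
    instance for each algorithm. *)
Require Import Defs.
From mathcomp Require Import all_boot all_order all_algebra.
From mathcomp Require Import all_classical all_reals all_analysis.
From mathcomp Require Import measurable_realfun ring lra.
Import Order.TTheory GRing.Theory Num.Theory.
Import numFieldNormedType.Exports.
Local Open Scope classical_set_scope.
Local Open Scope ring_scope.

Set Implicit Arguments.
Unset Strict Implicit.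
Unset Printing Implicit Defensive.

(** The domain is unbounded, so a query must gain nothing from its size. The correlations therefore
    use a saturated odd function of each coordinate: a point, however large, has an exponentially
    small chance of correlating with a block of random signs. The quadratic term keeps the gradient
    large where saturation has flattened the chain.

    The law of the samples may not depend on the query, so a sample carries a coin for each
    coordinate and the query point only selects the coins that act. At most one block is the
    frontier, hence each coordinate of the answer is affine in the acting coins and unbiased.

    The answers do leak information on the hidden signs, so these signs are not independent of the
    transcript. With fair coins they would be: flipping signs and coins together leaves the
    products, hence the answers, unchanged. Passing from biased to fair coins costs a likelihood
    ratio of second moment at most [expR (del ^+ 2 * (K * m)%:R)]. This exponent and the one of the
    Chernoff bound are both proportional to [m], so a small [del ^+ 2 * K] suffices in any
    dimension. *)

Section ramp.
Context {R : realType}.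
Implicit Types h s t : R.

Definition pospart s : R := Num.max 0 s.

(** A hat of height and half-width [h] centred at 0. Its primitive [ramp] is a smooth step with
    Lipschitz derivative, and the inequalities about both reduce to case analysis on polynomial
    pieces. *)
Definition tent h s := pospart (s + h) - 2 * pospart s + pospart (s - h).

Definition ramp h s :=
  2^-1 * (pospart (s + h) ^+ 2 - 2 * pospart s ^+ 2 + pospart (s - h) ^+ 2).

(** The kink at 0 needs no separate treatment: for all signs of [s] and [h + s], the difference
    quotient is within [|h|] of the derivative. *)
Lemma is_derive_pospart_sqr s :
  is_derive s 1 (fun t => pospart t ^+ 2) (2 * pospart s).
Proof.
have key : h^-1 *: (pospart (h *: 1 + s) ^+ 2 - pospart s ^+ 2)
    @[h --> (0 : R)^'] --> 2 * pospart s.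
  apply/cvgrPdist_le => e e0.
  near=> h.
  have h0 : h != 0 by near: h; exact: nbhs_dnbhs_neq.
  have he : `|h| <= e by near: h; apply: dnbhs0_le.
  apply: le_trans he; rewrite /GRing.scale /= mulr1.
  have -> : 2 * pospart s - h^-1 * (pospart (h + s) ^+ 2 - pospart s ^+ 2) =
      h^-1 * (h * (2 * pospart s) - (pospart (h + s) ^+ 2 - pospart s ^+ 2)).
    by field.
  rewrite normrM normfV -[leRHS](mulKf (_ : `|h| != 0)) ?normr_eq0//.
  rewrite ler_wpM2l ?invr_ge0// -expr2 real_normK ?num_real// /pospart.
  by case: (leP 0 (h + s)); case: (leP 0 s) => *;
    rewrite ler_norml; apply/andP; split; nra.
split; first by apply/cvg_ex; exists (2 * pospart s).
exact: cvg_lim key.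
Unshelve. all: by end_near. Qed.

Lemma tent_ge0 h s : 0 <= h -> 0 <= tent h s.
Proof.
move=> h0; rewrite /tent /pospart.
by case: (leP 0 (s + h)); case: (leP 0 s); case: (leP 0 (s - h)) => *; lra.
Qed.

Lemma tent_le h s : 0 <= h -> tent h s <= h.
Proof.
move=> h0; rewrite /tent /pospart.
by case: (leP 0 (s + h)); case: (leP 0 s); case: (leP 0 (s - h)) => *; lra.
Qed.

(** The constant is the sum 1 + 2 + 1 of the weights of the three positive parts. *)
Lemma tent_lipschitz h s t : `|tent h s - tent h t| <= 4 * `|s - t|.
Proof.
have pos_lip a b : `|pospart a - pospart b| <= `|a - b|.
  have := ler_norm (a - b); have := ler_norm (b - a); rewrite [`|b - a|]distrC.
  by rewrite ler_norml /pospart; case: (leP 0 a); case: (leP 0 b) => *; lra.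
have := pos_lip (s - h) (t - h); have := pos_lip (s + h) (t + h).
have -> : s + h - (t + h) = s - t by ring.
have -> : s - h - (t - h) = s - t by ring.
have := pos_lip s t; rewrite /tent !ler_norml => /andP[? ?] /andP[? ?] /andP[? ?].
by apply/andP; split; lra.
Qed.

Lemma tent_eq0 h s : 0 <= h -> s <= - h -> tent h s = 0.
Proof. by rewrite /tent /pospart => h0 sh; rewrite !max_l ?mulr0 ?subrr ?addr0//; lra. Qed.

Lemma ramp_ge0 h s : 0 <= h -> 0 <= ramp h s.
Proof.
move=> h0; rewrite /ramp /pospart.
by case: (leP 0 (s + h)); case: (leP 0 s); case: (leP 0 (s - h)) => *; nra.
Qed.

Lemma rampN h s : ramp h (- s) = h ^+ 2 - ramp h s.
Proof.
have posN a : pospart (- a) ^+ 2 = a ^+ 2 - pospart a ^+ 2.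
  by rewrite /pospart; case: (leP 0 (- a)); case: (leP 0 a) => *; nra.
rewrite /ramp; have -> : - s + h = - (s - h) by ring.
have -> : - s - h = - (s + h) by ring.
by rewrite !posN; field.
Qed.

Lemma ramp_le h s : 0 <= h -> ramp h s <= h ^+ 2.
Proof. by move=> h0; rewrite -subr_ge0 -rampN ramp_ge0. Qed.

Lemma ramp_eq0 h s : 0 <= h -> s <= - h -> ramp h s = 0.
Proof.
rewrite /ramp /pospart => h0 sh.
by rewrite !max_l ?expr0n/= ?mulr0 ?subrr ?addr0 ?mulr0//; lra.
Qed.

Lemma ramp_full h s : 0 <= h -> h <= s -> ramp h s = h ^+ 2.
Proof. by rewrite /ramp /pospart => h0 sh; rewrite !max_r; lra. Qed.

Lemma tentN h s : tent h (- s) = tent h s.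
Proof.
have posN a : pospart (- a) = pospart a - a.
  by rewrite /pospart; case: (leP 0 (- a)); case: (leP 0 a) => *; lra.
rewrite /tent; have -> : - s + h = - (s - h) by ring.
have -> : - s - h = - (s + h) by ring.
by rewrite !posN; ring.
Qed.

Lemma is_derive_ramp h s : is_derive s 1 (ramp h) (tent h s).
Proof.
have D a : is_derive s 1 (fun t => pospart (t + a) ^+ 2) (2 * pospart (s + a)).
  rewrite -[X in is_derive _ _ _ X]mulr1.
  apply: (@is_derive1_comp _ (fun t => pospart t ^+ 2) (+%R^~ a)).
    exact: is_derive_pospart_sqr.
  rewrite -[X in is_derive _ _ _ X](addr0 1); apply: is_deriveD.
have D0 := D 0; rewrite !addr0 in D0.
pose f a t := pospart (t + a) ^+ 2.
have -> : ramp h = 2^-1 *: (f h - 2 *: f 0 + f (- h)).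
  apply/funext => t; rewrite /ramp /f !fctE /= addr0; congr (_ * _).
have -> : tent h s = 2^-1 *: (2 * pospart (s + h) - 2 *: (2 * pospart (s + 0))
    + 2 * pospart (s - h)).
  by rewrite /tent addr0 /GRing.scale /=; field.
apply: is_deriveZ; apply: is_deriveD; apply: is_deriveB.
Qed.

Lemma derive_bounded_lipschitz (f df : R -> R) (C : R) :
    (forall s, is_derive s 1 f (df s)) -> (forall s, `|df s| <= C) ->
  forall s t, `|f s - f t| <= C * `|s - t|.
Proof.
move=> Df dfC.
suff ordered s t : t <= s -> `|f s - f t| <= C * `|s - t|.
  by move=> s t; case: (leP t s) => [/ordered//|/ltW/ordered];
    rewrite distrC (distrC t).
move=> ts; have [|c _ ->] := MVT_segment ts (fun x _ => Df x).
  by apply: derivable_within_continuous => x _; exact: ex_derive.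
by rewrite normrM ler_wpM2r.
Qed.

Lemma ramp_lipschitz h s t : 0 <= h -> `|ramp h s - ramp h t| <= h * `|s - t|.
Proof.
move=> h0; apply: derive_bounded_lipschitz => x; first exact: is_derive_ramp.
by rewrite ger0_norm ?tent_ge0 ?tent_le.
Qed.

End ramp.

(** * Partition of the coordinates into blocks *)

Section blocks.
Variables (T m : nat).
Hypothesis m_gt0 : (0 < m)%N.

(* Blocks are numbered from 1, so that index 0 can stand for an artificial
   block that is always discovered. *)
Definition block (k : nat) : nat := (k %/ m).+1.

Lemma block_le (k : 'I_(T * m)) : (block k <= T)%N.
Proof. by rewrite /block ltn_divLR. Qed.

Lemma card_block (i : nat) : (0 < i <= T)%N ->
  #|[pred k : 'I_(T * m) | block k == i]| = m.
Proof.
case: i => // i /= iT; rewrite -sum1_card.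
rewrite (eq_bigl (fun k : 'I_(T * m) => (k %/ m)%N == i)); last first.
  by move=> k; rewrite inE eqSS.
rewrite -(big_mkord (fun k => k %/ m == i)%N (fun=> 1%N)).
rewrite (big_cat_nat (leq0n (i * m))) ?leq_mul2r ?(ltnW iT) ?orbT//=.
rewrite (big_cat_nat (_ : i * m <= i.+1 * m)%N) ?leq_mul2r ?iT ?leqnSn ?orbT//=.
rewrite big_nat_cond big_pred0 ?add0n; last first.
  by move=> k /=; rewrite -ltn_divLR// ltn_neqAle andbAC andNb.
rewrite [X in (_ + X)%N]big_nat_cond [X in (_ + X)%N]big_pred0 ?addn0; last first.
  by move=> k; rewrite -leq_divRL//; case: eqP => [->|]; rewrite ?ltnn ?andbF.
rewrite big_nat_cond (eq_bigl (fun k => i * m <= k < i.+1 * m)%N); last first.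
  move=> k; rewrite -leq_divRL// -ltn_divLR// ltnS -eqn_leq eq_sym andbb.
  by rewrite eq_sym.
by rewrite -big_nat sum_nat_const_nat muln1 mulSn addnK.
Qed.

(** Index 0 and the indices beyond [T] have no coordinates, so the bound holds for every [i]. *)
Lemma card_block_le (i : nat) : (#|[pred k : 'I_(T * m) | block k == i]| <= m)%N.
Proof.
have [iT|iT] := boolP (0 < i <= T)%N; first by rewrite card_block.
rewrite (eq_card0 (_ : _ =i pred0))// => k; rewrite !inE.
by apply: contraNF iT => /eqP <-; exact: block_le.
Qed.

End blocks.

(** * The chain of blocks *)

Section chain.
Context {R : realType}.
Variables (T m : nat).
Hypothesis m_gt0 : (0 < m)%N.
Local Notation d := (T * m)%N.
Local Notation block := (block m).
Implicit Types (w u : 'I_d -> R) (i : nat) (k : 'I_d).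

Definition saturate (s : R) : R := ramp 1 s - 2^-1.

(** Centre 3/16 and half-width 1/16 place the transition between 1/8, the threshold of discovery,
    and 1/4; the factor 256 makes the height 1. *)
Definition gate (t : R) : R := 256 * ramp 16^-1 (t - 3 / 16).

Definition dgate (t : R) : R := 256 * tent 16^-1 (t - 3 / 16).

Definition corr w u i : R :=
  (i == 0%N)%:R + m%:R^-1 * \sum_(k < d | block k == i) w k * saturate (u k).

(** The shift by 1/2 makes the second factor nonnegative for weights bounded by 1. This keeps
    [slope] nonnegative, which the lower bound on the gradient relies on. *)
Definition chain w u : R :=
  \sum_(i < T.+1) gate (corr w u i) * (corr w u i.+1 + 2^-1).

(** For [w' = w] and positive [i], the derivative of [chain] in the correlation of block [i], which
    enters as the successor of [i.-1] and through its own gate. The gates keep the true weights,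
    since noise inside a nonlinear function would bias the answer. *)
Definition slope w w' u i : R :=
  gate (corr w u i.-1) + dgate (corr w u i) * (corr w' u i.+1 + 2^-1).

(* For [w' = w] this is [m] times the gradient of
   [- chain w u + (2 m)^-1 \sum_k u k ^+ 2].  The oracle perturbs only the
   occurrences of the weights that are collected in [w']. *)
Definition chain_grad w w' u k : R :=
  u k - w' k * tent 1 (u k) * slope w w' u (block k).

Let mR_gt0 : 0 < m%:R :> R. Proof. by rewrite ltr0n. Qed.

Lemma saturate_norm_le s : `|saturate s| <= 2^-1.
Proof.
have := ramp_ge0 s (@ler01 R); have := ramp_le s (@ler01 R).
by rewrite expr1n /saturate ler_norml => *; lra.
Qed.

Lemma saturateN s : saturate (- s) = - saturate s.
Proof. by rewrite /saturate rampN expr1n; field. Qed.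

Lemma gate_ge0 t : 0 <= gate t.
Proof. by rewrite mulr_ge0 ?ler0n ?ramp_ge0. Qed.

Lemma gate_le1 t : gate t <= 1.
Proof. by have := @ramp_le R 16^-1 (t - 3 / 16); rewrite /gate; lra. Qed.

Lemma dgate_ge0 t : 0 <= dgate t.
Proof. by rewrite mulr_ge0 ?ler0n ?tent_ge0. Qed.

Lemma dgate_le t : dgate t <= 16.
Proof. by have := @tent_le R 16^-1 (t - 3 / 16); rewrite /dgate; lra. Qed.

Lemma gate_eq0 t : t <= 8^-1 -> gate t = 0.
Proof. by move=> t8; rewrite /gate ramp_eq0 ?mulr0//; lra. Qed.

Lemma dgate_eq0 t : t <= 8^-1 -> dgate t = 0.
Proof. by move=> t8; rewrite /dgate tent_eq0 ?mulr0//; lra. Qed.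

Lemma gate_eq1 t : 4^-1 <= t -> gate t = 1.
Proof. by move=> t4; rewrite /gate ramp_full; lra. Qed.

Lemma gate_lipschitz s t : `|gate s - gate t| <= 16 * `|s - t|.
Proof.
rewrite /gate -mulrBr normrM (ger0_norm (ler0n _ 256)).
have := @ramp_lipschitz R 16^-1 (s - 3 / 16) (t - 3 / 16).
by rewrite (_ : s - _ - _ = s - t); [lra|ring].
Qed.

Lemma dgate_lipschitz s t : `|dgate s - dgate t| <= 1024 * `|s - t|.
Proof.
rewrite /dgate -mulrBr normrM (ger0_norm (ler0n _ 256)).
have := @tent_lipschitz R 16^-1 (s - 3 / 16) (t - 3 / 16).
by rewrite (_ : s - _ - (_ - _) = s - t); [lra|ring].
Qed.

Lemma corr0 w u : corr w u 0 = 1.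
Proof. by rewrite /corr eqxx big_pred0 ?mulr0 ?addr0// => k; rewrite /block. Qed.

Lemma corrS w u i : corr w u i.+1 =
  m%:R^-1 * \sum_(k < d | block k == i.+1) w k * saturate (u k).
Proof. by rewrite /corr /= mulr0n add0r. Qed.

Lemma corr_large w u i : (T < i)%N -> corr w u i = 0.
Proof.
move=> Ti; rewrite /corr big_pred0 ?mulr0 ?addr0.
  by case: eqP Ti => [->|].
by move=> k; apply: contraTF Ti => /eqP <-; rewrite -leqNgt block_le.
Qed.

Lemma block_sum_norm_le (g : 'I_d -> R) (C : R) i : 0 <= C ->
  (forall k, `|g k| <= C) -> `|m%:R^-1 * \sum_(k < d | block k == i) g k| <= C.
Proof.
move=> C0 gC; rewrite normrM gtr0_norm ?invr_gt0// ler_pdivrMl//.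
apply: le_trans (ler_norm_sum _ _ _) _.
apply: le_trans (ler_sum _ (fun k _ => gC k)) _.
by rewrite sumr_const -[leLHS]mulr_natl ler_wpM2r// ler_nat card_block_le.
Qed.

Lemma corrS_norm_le w u i (C : R) : 0 <= C -> (forall k, `|w k| <= C) ->
  `|corr w u i.+1| <= C / 2.
Proof.
move=> C0 wC; rewrite corrS; apply: block_sum_norm_le; first by lra.
by move=> k; rewrite normrM ler_pM// saturate_norm_le.
Qed.

Lemma corrS_bounds w u i : (forall k, `|w k| <= 1) ->
  0 <= corr w u i.+1 + 2^-1 <= 1.
Proof.
by move=> w1; have := corrS_norm_le u i ler01 w1; rewrite ler_norml; lra.
Qed.

(** Block [T.+1] is empty, so the last summand is at most 1/2. This 1/2 cancels the value of [chain]
    at 0, and the gap of the hard function is at most [al * T%:R]. *)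
Lemma chain_bounds w u : (forall k, `|w k| <= 1) ->
  0 <= chain w u <= T%:R + 2^-1.
Proof.
move=> w1; apply/andP; split.
  apply: sumr_ge0 => i _; rewrite mulr_ge0 ?gate_ge0//.
  by have /andP[] := corrS_bounds u i w1.
rewrite /chain big_ord_recr/= (corr_large w u (ltnSn T)) add0r lerD//; last first.
  by rewrite ler_piMl ?gate_le1.
have -> : T%:R = \sum_(i < T) 1 :> R by rewrite sumr_const card_ord.
rewrite ler_sum// => i _.
have /andP[c0 c1] := corrS_bounds u i w1.
by rewrite -[leRHS]mulr1 ler_pM ?gate_ge0 ?gate_le1.
Qed.

Lemma chain0 w : chain w (fun=> 0) = 2^-1.
Proof.
have saturate0 : saturate 0 = 0.
  by have := saturateN 0; rewrite oppr0; lra.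
have corrS0 i : corr w (fun=> 0) i.+1 = 0.
  by rewrite corrS big1 ?mulr0// => k _; rewrite saturate0 mulr0.
rewrite /chain big_ord_recl corr0 corrS0 gate_eq1; last by lra.
rewrite big1 => [|i _]; first by ring.
by rewrite lift0 !corrS0 gate_eq0 ?mul0r; lra.
Qed.

Lemma slope_bounds w u i : (forall k, `|w k| <= 1) -> 0 <= slope w w u i <= 17.
Proof.
move=> w1; have /andP[c0 c1] := corrS_bounds u i w1.
apply/andP; split.
  by apply: addr_ge0; [exact: gate_ge0|apply: mulr_ge0; [exact: dgate_ge0|]].
have : dgate (corr w u i) * (corr w u i.+1 + 2^-1) <= 16 * 1.
  by apply: ler_pM => //; [exact: dgate_ge0|exact: dgate_le].
by have := gate_le1 (corr w u i.-1); rewrite /slope; lra.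
Qed.

(** Jensen's inequality, by expanding the sum of the squares of [a k - D]. *)
Lemma block_mean_sqr (a : 'I_d -> R) i :
  (m%:R^-1 * \sum_(k < d | block k == i) a k) ^+ 2 <=
  m%:R^-1 * \sum_(k < d | block k == i) a k ^+ 2.
Proof.
set D := _ * _; have DE : \sum_(k < d | block k == i) a k = m%:R * D.
  by rewrite mulVKf// gt_eqF.
have : 0 <= \sum_(k < d | block k == i) (a k - D) ^+ 2.
  by apply: sumr_ge0 => k _; exact: sqr_ge0.
have -> : \sum_(k < d | block k == i) (a k - D) ^+ 2 =
    \sum_(k < d | block k == i) a k ^+ 2 - 2 * D * (m%:R * D) +
    \sum_(k < d | block k == i) D ^+ 2.
  by rewrite -DE mulr_sumr -sumrB -big_split/=; apply: eq_bigr => k _; ring.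
rewrite sumr_const -[X in _ + X]mulr_natl.
have : #|[pred k : 'I_d | block k == i]|%:R * D ^+ 2 <= m%:R * D ^+ 2.
  by rewrite ler_wpM2r ?sqr_ge0// ler_nat card_block_le.
by rewrite ler_pdivlMl//; lra.
Qed.

(** By injectivity each [a l] occurs in the averages attached to the coordinates of a single block,
    that is, at most [m] times. Injectivity is asked on positive numbers only, so that [predn]
    qualifies. *)
Lemma sum_over_blocks (a : 'I_d -> R) (f : nat -> nat) :
    (forall k, 0 <= a k) -> {in [pred i | 0 < i]%N &, injective f} ->
  \sum_(k < d) m%:R^-1 * \sum_(l < d | block l == f (block k)) a l <=
  \sum_(l < d) a l.
Proof.
move=> a0 f_inj; rewrite -mulr_sumr ler_pdivrMl//.
rewrite (exchange_big_dep xpredT)//= mulr_sumr ler_sum// => l _.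
rewrite sumr_const -[leLHS]mulr_natl ler_wpM2r// ler_nat.
have [k fk|none] := pickP [pred k : 'I_d | block l == f (block k)]; last first.
  by rewrite (eq_card0 (_ : _ =i pred0))// => k; exact: none.
apply: leq_trans (card_block_le T m_gt0 (block k)); apply: subset_leq_card.
apply/fintype.subsetP => k'; rewrite !inE in fk * => /eqP fk'; apply/eqP.
by apply: f_inj; rewrite ?inE// -fk' (eqP fk).
Qed.
End chain.

Section chain_gradient.
Context {R : realType}.
Variables (T m : nat).
Hypothesis m_gt0 : (0 < m)%N.
Local Notation d := (T * m)%N.
Local Notation block := (block m).
Local Notation corr := (@corr R T m).
Local Notation slope := (@slope R T m).
Local Notation chain_grad := (@chain_grad R T m).
Implicit Types (w u z : 'I_d -> R) (i : nat) (k : 'I_d).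

Let mR_gt0 : 0 < m%:R :> R. Proof. by rewrite ltr0n. Qed.

(** A coordinate of the gradient depends on [u] there and on the correlations of three consecutive
    blocks. A correlation moves by at most the mean displacement in its block, so Jensen's
    inequality gives a constant independent of [T] and [m]. *)
Lemma chain_grad_lipschitz w u u' : (forall k, `|w k| <= 1) ->
  \sum_(k < d) (chain_grad w w u k - chain_grad w w u' k) ^+ 2 <=
  2 ^+ 24 * \sum_(k < d) (u k - u' k) ^+ 2.
Proof.
move=> w1; pose a k : R := `|u k - u' k|.
pose D i : R := m%:R^-1 * \sum_(k < d | block k == i) a k.
have D_ge0 i : 0 <= D i.
  by rewrite mulr_ge0 ?invr_ge0 ?ler0n// sumr_ge0// => k _; exact: normr_ge0.
have corrB i : `|corr w u i - corr w u' i| <= D i.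
  rewrite /corr opprD addrACA subrr add0r -mulrBr -sumrB normrM gtr0_norm ?invr_gt0//.
  rewrite ler_wpM2l ?invr_ge0 ?ler0n//; apply: le_trans (ler_norm_sum _ _ _) _.
  apply: ler_sum => k _; rewrite -mulrBr normrM /saturate opprB addrA subrK.
  have := ramp_lipschitz (u k) (u' k) (@ler01 R); rewrite mul1r.
  by apply: le_trans; rewrite ler_piMl.
have slopeB i : `|slope w w u i - slope w w u' i| <=
    16 * D i.-1 + 1024 * D i + 16 * D i.+1.
  have /andP[c0 c1] := corrS_bounds m_gt0 u i w1.
  have -> : slope w w u i - slope w w u' i =
    (gate (corr w u i.-1) - gate (corr w u' i.-1)) +
    ((dgate (corr w u i) - dgate (corr w u' i)) * (corr w u i.+1 + 2^-1) +
    dgate (corr w u' i) * (corr w u i.+1 - corr w u' i.+1)).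
    by rewrite /slope; ring.
  have e1 := gate_lipschitz (corr w u i.-1) (corr w u' i.-1).
  have e2 : `|(dgate (corr w u i) - dgate (corr w u' i)) *
      (corr w u i.+1 + 2^-1)| <= 1024 * D i * 1.
    rewrite normrM ler_pM//; last by rewrite ger0_norm.
    by have := dgate_lipschitz (corr w u i) (corr w u' i); have := corrB i; lra.
  have e3 : `|dgate (corr w u' i) * (corr w u i.+1 - corr w u' i.+1)| <=
      16 * D i.+1.
    by rewrite normrM ler_pM// ger0_norm ?dgate_ge0 ?dgate_le.
  have -> : 16 * D i.-1 + 1024 * D i + 16 * D i.+1 =
    16 * D i.-1 + (1024 * D i * 1 + 16 * D i.+1) by ring.
  apply: le_trans (ler_normD _ _) _; apply: lerD.
    by have := corrB i.-1; lra.
  by apply: le_trans (ler_normD _ _) _; exact: lerD.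
(* 69 = 1 + 4 * 17: the linear term, and the Lipschitz constant of [tent] times the bound on the
   slope. *)
have gradB k : `|chain_grad w w u k - chain_grad w w u' k| <=
    69 * a k + 16 * D (block k).-1 + 1024 * D (block k) + 16 * D (block k).+1.
  have /andP[s0 s17] := slope_bounds m_gt0 u (block k) w1.
  rewrite (_ : _ - _ = (u k - u' k) - w k * ((tent 1 (u k) - tent 1 (u' k)) *
    slope w w u (block k) + tent 1 (u' k) *
    (slope w w u (block k) - slope w w u' (block k)))); last first.
    by rewrite /chain_grad; ring.
  apply: le_trans (ler_normB _ _) _; rewrite normrM.
  set e := _ + _ * _.
  have we : `|w k| * `|e| <= `|e| by rewrite ler_piMl.
  have : `|e| <= 4 * a k * 17 + 1 * `|slope w w u (block k) - slope w w u' (block k)|.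
    apply: le_trans (ler_normD _ _) _; rewrite !normrM lerD//.
      by rewrite ler_pM ?tent_lipschitz// ger0_norm.
    by rewrite ler_wpM2r// ger0_norm ?tent_ge0 ?tent_le.
  by have := slopeB (block k); rewrite -/(a k); lra.
have sqr4 (x y t s : R) :
    (x + y + t + s) ^+ 2 <= 4 * (x ^+ 2 + y ^+ 2 + t ^+ 2 + s ^+ 2).
  rewrite -subr_ge0 (_ : _ - _ = (x - y) ^+ 2 + (x - t) ^+ 2 + (x - s) ^+ 2 +
    (y - t) ^+ 2 + (y - s) ^+ 2 + (t - s) ^+ 2); last by ring.
  by rewrite !addr_ge0 ?sqr_ge0.
have Dsum (f : nat -> nat) : {in [pred i | 0 < i]%N &, injective f} ->
    \sum_(k < d) D (f (block k)) ^+ 2 <= \sum_(k < d) a k ^+ 2.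
  move=> /(sum_over_blocks m_gt0 (fun k => sqr_ge0 (a k))); apply: le_trans.
  by apply: ler_sum => k _; exact: block_mean_sqr.
have gradB2 k : (chain_grad w w u k - chain_grad w w u' k) ^+ 2 <=
    4 * ((69 * a k) ^+ 2 + (16 * D (block k).-1) ^+ 2 +
      (1024 * D (block k)) ^+ 2 + (16 * D (block k).+1) ^+ 2).
  apply: le_trans (sqr4 _ _ _ _); rewrite -[leLHS]real_normK ?num_real//.
  apply: lerXn2r (gradB k); rewrite nnegrE; first exact: normr_ge0.
  by do !apply: addr_ge0; (apply: mulr_ge0; first exact: ler0n);
    rewrite ?D_ge0 ?normr_ge0.
apply: le_trans (ler_sum _ (fun k _ => gradB2 k)) _.
rewrite -mulr_sumr !big_split/=; under eq_bigr do rewrite exprMn.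
under [X in _ + X + _ + _]eq_bigr do rewrite exprMn.
under [X in _ + _ + X + _]eq_bigr do rewrite exprMn.
under [X in _ + _ + _ + X]eq_bigr do rewrite exprMn.
rewrite -!mulr_sumr.
have -> : \sum_(k < d) (u k - u' k) ^+ 2 = \sum_(k < d) a k ^+ 2.
  by apply: eq_bigr => k _; rewrite real_normK ?num_real.
have := Dsum id (fun _ _ _ _ => id); have := Dsum succn (fun _ _ _ _ => @succn_inj _ _).
have /Dsum : {in [pred i | 0 < i]%N &, injective predn} by move=> [|i] [|j]//= _ _ ->.
have : 0 <= \sum_(k < d) a k ^+ 2 by apply: sumr_ge0 => k _; exact: sqr_ge0.
(* 4 * (69^2 + 16^2 + 1024^2 + 16^2) is below 2^24. *)
move=> /=; lra.
Qed.

(** At 1/2, where [tent 1 s = s], the saturation is 3/8. The next lemma treats the other side of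
    this point; together they bound [|s - tent 1 s * S|] below by [3 / 8 - saturate s] whenever [S]
    is at least 1. *)
Lemma saturate_ge (s : R) : 2^-1 <= s -> 3 / 8 <= saturate s.
Proof.
rewrite /saturate /ramp /pospart => s2.
by case: (leP 0 (s + 1)); case: (leP 0 s); case: (leP 0 (s - 1)) => *; nra.
Qed.

Lemma tent_saturate_ge (s : R) : s <= 2^-1 -> 3 / 8 - saturate s <= tent 1 s - s.
Proof.
rewrite /saturate /ramp /tent /pospart => s2.
by case: (leP 0 (s + 1)); case: (leP 0 s); case: (leP 0 (s - 1)) => *; nra.
Qed.

(** The open gate of [i.-1] makes the slope at least 1 in block [i], and there the pointwise bound
    averages to [3 / 8 - corr w u i], which is at least 1/8. *)
Lemma chain_grad_large w u i : (forall k, `|w k| = 1) -> (0 < i <= T)%N ->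
    4^-1 <= corr w u i.-1 -> corr w u i <= 4^-1 ->
  m%:R / 64 <= \sum_(k < d) chain_grad w w u k ^+ 2.
Proof.
move=> w1 iT prev cur.
have w1' k : `|w k| <= 1 by rewrite w1.
have wk k : w k = 1 \/ w k = -1.
  by move: (w1 k); rewrite -[X in _ = X]normr1 => /eqP; rewrite eqr_norm2 =>
    /orP[]/eqP; [left|right].
have slope1 : 1 <= slope w w u i.
  rewrite /slope gate_eq1// lerDl mulr_ge0 ?dgate_ge0//.
  by have /andP[] := corrS_bounds m_gt0 u i w1'.
have pointwise s (S : R) : 1 <= S -> 3 / 8 - saturate s <= `|s - tent 1 s * S|.
  move=> S1; have [s2|s2] := leP 2^-1 s.
    by have := saturate_ge s2; have := normr_ge0 (s - tent 1 s * S); lra.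
  have := tent_saturate_ge (ltW s2); have := tent_ge0 s (@ler01 R).
  have := ler_norm (- (s - tent 1 s * S)); rewrite normrN; nra.
(* The square is bounded below by its tangent at 1/8, which is linear and can be summed: the block
   yields at least m * (1/32 - 1/64). Multiplying by the sign [w k] reduces to the scalar bound. *)
have grad_ge k : block k == i ->
    (3 / 8 - w k * saturate (u k)) / 4 - 64^-1 <= chain_grad w w u k ^+ 2.
  move=> /eqP ki; rewrite /chain_grad ki.
  have := pointwise (w k * u k) _ slope1; set H := u k - _.
  have -> : saturate (w k * u k) = w k * saturate (u k).
    by case: (wk k) => ->; rewrite ?mul1r// !mulN1r saturateN.
  have -> : w k * u k - tent 1 (w k * u k) * slope w w u i = w k * H.
    rewrite /H; case: (wk k) => ->; rewrite ?mul1r// !mulN1r tentN; ring.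
  rewrite normrM w1 mul1r -(real_normK (num_real H)).
  by have := sqr_ge0 (`|H| - 8^-1); lra.
apply: le_trans (_ : \sum_(k < d | block k == i) chain_grad w w u k ^+ 2 <= _);
  last first.
  by rewrite [leRHS](bigID (fun k : 'I_d => block k == i))/= lerDl sumr_ge0// => k _;
    exact: sqr_ge0.
apply: le_trans (ler_sum _ grad_ge).
rewrite sumrB -mulr_suml sumrB !sumr_const card_block//.
case: i iT cur {prev slope1 grad_ge} => // i iT.
rewrite corrS ler_pdivrMl// -(mulr_natl (3 / 8)) -(mulr_natl 64^-1).
lra.
Qed.
End chain_gradient.

(** * The frontier and the noise *)

Section frontier.
Context {R : realType}.
Variables (T m : nat).
Hypothesis m_gt0 : (0 < m)%N.
Local Notation d := (T * m)%N.
Local Notation block := (block m).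
Local Notation corr := (@corr R T m).
Local Notation slope := (@slope R T m).
Local Notation chain_grad := (@chain_grad R T m).
Implicit Types (w u z : 'I_d -> R) (i j : nat) (k : 'I_d) (del : R).

Let mR_gt0 : 0 < m%:R :> R. Proof. by rewrite ltr0n. Qed.

Definition discovered w u i : bool := 8^-1 <= corr w u i.

(** The quantifier stops at [T], so [T.+1] is the frontier once block [T] is discovered. *)
Definition frontier (disc : nat -> bool) i : bool :=
  disc i.-1 && [forall l : 'I_T.+1, (i <= l)%N ==> ~~ disc l].

Definition noisy del w z u k : R :=
  if frontier (discovered w u) (block k) then w k * z k / del else w k.

Lemma frontier_inj (disc : nat -> bool) i j : (0 < i <= T.+1)%N ->
  (0 < j <= T.+1)%N -> frontier disc i -> frontier disc j -> i = j.
Proof.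
suff le i' j' : (0 < i' <= T.+1)%N -> (0 < j' <= T.+1)%N ->
    frontier disc i' -> frontier disc j' -> (i' <= j')%N.
  by move=> i0 j0 fi fj; apply/eqP; rewrite eqn_leq; apply/andP; split; exact: le.
case: i' => // i' /= i'T _ /andP[di _] /andP[_ /forallP/(_ (Ordinal i'T))].
by rewrite di implybF /= -ltnNge.
Qed.

(** The frontier is unique, so the coordinates that are counted lie in one block: the frontier for
    [f = id], the block before it for [f = succn]. *)
Lemma sum_frontier_le (disc : nat -> bool) (f : nat -> nat) :
    {in [pred i | 0 < i <= T]%N &, injective f} ->
    (forall i, (0 < i <= T)%N -> (0 < f i <= T.+1)%N) ->
  \sum_(k < d) (frontier disc (f (block k)))%:R <= m%:R :> R.
Proof.
move=> f_inj fT; rewrite -natr_sum ler_nat.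
have [k0 fk0|none] := pickP [pred k : 'I_d | frontier disc (f (block k))].
  apply: leq_trans (card_block_le T m_gt0 (block k0)).
  rewrite -sum1_card [leqRHS]big_mkcond/=; apply: leq_sum => k _.
  have kT : (0 < block k <= T)%N := block_le m_gt0 k.
  have k0T : (0 < block k0 <= T)%N := block_le m_gt0 k0.
  rewrite inE; have [_|/eqP neq] := eqVneq (block k) (block k0); first by case: (frontier _ _).
  case: (boolP (frontier _ _)) => // fk; case: neq; apply: f_inj => //.
  by apply: frontier_inj fk fk0; exact: fT.
by rewrite big1// => k _; move: (none k) => /= ->.
Qed.

Lemma corr_eq_on w w' u i :
  (forall k, block k = i -> w k = w' k) -> corr w u i = corr w' u i.
Proof.
move=> ww'; congr (_ + _ * _); apply: eq_bigr => k /eqP/ww' -> //.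
Qed.

Lemma noisy_off del w z u k :
  ~~ frontier (discovered w u) (block k) -> noisy del w z u k = w k.
Proof. by rewrite /noisy => /negbTE ->. Qed.

Lemma corr_noisy_off del w z u i : ~~ frontier (discovered w u) i ->
  corr (noisy del w z u) u i = corr w u i.
Proof. by move=> fi; apply: corr_eq_on => k ki; rewrite noisy_off// ki. Qed.

Lemma frontierS (disc : nat -> bool) k :
  frontier disc (block k) -> ~~ frontier disc (block k).+1.
Proof.
move=> fk; apply/negP => fk1.
have kT := block_le m_gt0 k.
have kT1 : (0 < block k <= T.+1)%N by rewrite (leqW kT).
have /eqP := frontier_inj kT1 (kT : (0 < (block k).+1 <= T.+1)%N) fk fk1.
by rewrite eqn_leq ltnn andbF.
Qed.

(** Two blocks only are affected, whatever [T] is: the frontier, through the weight in front, by 2 /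
    del * 17 per coordinate, and the block before it, through the correlation of its successor, by
    16 / del. Finally 34^2 + 16^2 <= 38^2. *)
Lemma noise_le del w z u : 0 < del <= 1 ->
    (forall k, `|w k| <= 1) -> (forall k, `|z k| <= 1) ->
  \sum_(k < d) (chain_grad w (noisy del w z u) u k - chain_grad w w u k) ^+ 2
    <= m%:R * (38 / del) ^+ 2.
Proof.
move=> /andP[del0 del1] w1 z1; set w' := noisy del w z u.
have dV : 1 <= del^-1 by rewrite invf_ge1.
have w'B k : `|w' k - w k| <= 2 / del.
  rewrite /w' /noisy; case: ifP => _; last by rewrite subrr normr0; lra.
  have : `|w k * z k / del| <= 1 * del^-1.
    have dV0 : 0 <= del^-1 by lra.
    by rewrite !normrM (ger0_norm dV0) ler_wpM2r ?mulr_ile1.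
  have := ler_normB (w k * z k / del) (w k); have := w1 k; lra.
pose a k := (frontier (discovered w u) (block k))%:R : R.
pose b k := (frontier (discovered w u) (block k).+1)%:R : R.
have diff k : chain_grad w w' u k - chain_grad w w u k =
    tent 1 (u k) * (w k * slope w w u (block k) - w' k * slope w w' u (block k)).
  by rewrite /chain_grad; ring.
have tent1 k : `|tent 1 (u k)| <= 1 :> R.
  by rewrite ger0_norm ?tent_ge0 ?tent_le.
have pointwise k : (chain_grad w w' u k - chain_grad w w u k) ^+ 2 <=
    a k * (34 / del) ^+ 2 + b k * (16 / del) ^+ 2.
  have sqr_le (x y : R) : `|x| <= y -> x ^+ 2 <= y ^+ 2.
    by move=> xy; rewrite -[leLHS]real_normK ?num_real// lerXn2r ?nnegrE// (le_trans _ xy).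
  have tent_mul (x y : R) : `|x| <= y -> (tent 1 (u k) * x) ^+ 2 <= y ^+ 2.
    by move=> xy; apply: sqr_le; rewrite normrM -[y]mul1r ler_pM.
  rewrite diff /a /b; have [fk|fk] := boolP (frontier _ (block k)).
    have fk1 := frontierS fk.
    have -> : slope w w' u (block k) = slope w w u (block k).
      by rewrite /slope corr_noisy_off.
    rewrite (negbTE fk1) mul1r mul0r addr0; apply: tent_mul.
    rewrite -mulrBl normrM distrC; have := slope_bounds m_gt0 u (block k) w1.
    move=> /andP[s0 s17]; rewrite (_ : 34 / del = 2 / del * 17); last by ring.
    by rewrite ler_pM// ger0_norm.
  rewrite {1}/w' noisy_off// -mulrBr mul0r add0r.
  have [fk1|fk1] := boolP (frontier _ (block k).+1); last first.
    rewrite mul0r; rewrite (_ : slope w w' u (block k) = slope w w u (block k)).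
      by rewrite subrr !mulr0 expr0n.
    by rewrite /slope corr_noisy_off.
  rewrite mul1r; apply: tent_mul; rewrite normrM.
  have -> : slope w w u (block k) - slope w w' u (block k) =
      dgate (corr w u (block k)) *
      (corr w u (block k).+1 - corr w' u (block k).+1) by rewrite /slope; ring.
  have cB : `|corr w u (block k).+1 - corr w' u (block k).+1| <= 1 / del.
    rewrite !corrS -mulrBr -sumrB; under eq_bigr do rewrite -mulrBl.
    apply: block_sum_norm_le => [//||l]; first lra.
    rewrite normrM distrC (_ : 1 / del = 2 / del * 2^-1); last by field; lra.
    by rewrite ler_pM// saturate_norm_le.
  rewrite -[leRHS]mul1r ler_pM// normrM (_ : 16 / del = 16 * (1 / del)).
    by rewrite ler_pM// ger0_norm ?dgate_ge0 ?dgate_le.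
  by ring.
apply: le_trans (ler_sum _ (fun k _ => pointwise k)) _.
rewrite big_split/= -!mulr_suml.
have sa : \sum_(k < d) a k <= m%:R.
  by apply: (sum_frontier_le _ (f := id)) => // i /andP[-> /leqW ->].
have sb : \sum_(k < d) b k <= m%:R.
  apply: (sum_frontier_le _ (f := succn)); first by move=> i j _ _ [].
  by move=> i /andP[_ iT]; exact: iT.
rewrite !exprMn exprVn; have : 0 <= (del ^+ 2)^-1 by rewrite invr_ge0 sqr_ge0.
move: (del ^+ 2)^-1 (\sum_(k < d) a k) (\sum_(k < d) b k) sa sb => e x y xm ym e0.
have := ler_wpM2r e0 xm; have := ler_wpM2r e0 ym.
by have := mulr_ge0 (ltW mR_gt0) e0; lra.
Qed.

(** Two consecutive blocks are never both the frontier, so the two occurrences of [w'] in a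
    coordinate are not noisy together: the answer is affine in the coins and only their means
    enter. *)
Lemma chain_grad_unbiased (Z : finType) (p : Z -> R) (s : Z -> 'I_d -> R)
    del w u k : del != 0 -> \sum_q p q = 1 ->
    (forall l, \sum_q p q * s q l = del) ->
  \sum_q p q * chain_grad w (noisy del w (s q) u) u k = chain_grad w w u k.
Proof.
move=> del0 p1 sE.
have noisyE l : \sum_q p q * noisy del w (s q) u l = w l.
  rewrite /noisy; case: (frontier _ _); last by rewrite -mulr_suml p1 mul1r.
  rewrite (eq_bigr (fun q => w l / del * (p q * s q l))) => [|q _]; last by ring.
  by rewrite -mulr_sumr sE divfK.
pose N q l := noisy del w (s q) u l.
have corrE i : \sum_q p q * corr (N q) u i.+1 = corr w u i.+1.
  rewrite corrS; under eq_bigr => q _ do rewrite corrS mulrCA mulr_sumr.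
  rewrite -mulr_sumr exchange_big/=; congr (_ * _); apply: eq_bigr => l _.
  under eq_bigr => q _ do rewrite mulrA.
  by rewrite -mulr_suml noisyE.
have affine (c0 c1 : R) (f : Z -> R) :
    \sum_q p q * (c0 + c1 * f q) = c0 + c1 * \sum_q p q * f q.
  under eq_bigr => q _ do rewrite mulrDr mulrCA.
  by rewrite big_split/= -mulr_suml p1 mul1r -mulr_sumr.
have [fk|fk] := boolP (frontier (discovered w u) (block k)).
  have fk1 := frontierS fk.
  pose c := - (tent 1 (u k) * slope w w u (block k)).
  have E q : chain_grad w (N q) u k = u k + c * N q k.
    by rewrite /chain_grad /slope corr_noisy_off// -/(slope _ _ _ _) /c; ring.
  rewrite (eq_bigr (fun q => p q * (u k + c * N q k))) => [|q _]; last by rewrite -E.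
  by rewrite affine noisyE /chain_grad /c; ring.
pose c1 := - (w k * tent 1 (u k) * dgate (corr w u (block k))).
pose c0 := u k - w k * tent 1 (u k) *
  (gate (corr w u (block k).-1) + dgate (corr w u (block k)) * 2^-1).
have E w' : w' k = w k ->
    chain_grad w w' u k = c0 + c1 * corr w' u (block k).+1.
  by rewrite /chain_grad /slope => ->; rewrite /c0 /c1; ring.
rewrite (eq_bigr (fun q => p q * (c0 + c1 * corr (N q) u (block k).+1))).
  by rewrite affine corrE -E.
by move=> q _; rewrite E// noisy_off.
Qed.

(* An answer carries no information on an undiscovered block other than the
   products of its weights with the noise, and not even these when the
   preceding block is undiscovered. *)
Lemma chain_grad_local del w1 w2 z1 z2 u i : (0 < i)%N ->
    (forall k, block k != i -> w1 k = w2 k) ->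
    (forall k, block k != i -> z1 k = z2 k) ->
    (forall l, (i <= l)%N -> ~~ discovered w1 u l) -> ~~ discovered w2 u i ->
    (discovered w1 u i.-1 -> forall k, block k = i -> w1 k * z1 k = w2 k * z2 k) ->
  chain_grad w1 (noisy del w1 z1 u) u =1 chain_grad w2 (noisy del w2 z2 u) u.
Proof.
move=> i0 ww zz disc1 disc2 wz k.
have corrE l : l != i -> corr w1 u l = corr w2 u l.
  by move=> li; apply: corr_eq_on => k' k'l; apply: ww; rewrite k'l.
have discE l : discovered w1 u l = discovered w2 u l.
  have [->|li] := eqVneq l i; last by rewrite /discovered corrE.
  by rewrite (negbTE disc2) (negbTE (disc1 i _)).
have frontE : frontier (discovered w1 u) = frontier (discovered w2 u).
  by congr (frontier _); apply/funext.
have noisyE (l : 'I_d) : block l != i -> noisy del w1 z1 u l = noisy del w2 z2 u l.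
  by move=> li; rewrite /noisy frontE ww ?zz.
have frontier_i : discovered w1 u i.-1 -> frontier (discovered w2 u) i.
  move=> di; rewrite -frontE /frontier di; apply/forallP => l; apply/implyP.
  exact: disc1.
have noisy_i : discovered w1 u i.-1 ->
    forall l : 'I_d, block l = i -> noisy del w1 z1 u l = noisy del w2 z2 u l.
  by move=> di l li; rewrite /noisy frontE li frontier_i// wz.
have gate0 w l : ~~ discovered w u l -> gate (corr w u l) = 0.
  by rewrite -ltNge => /ltW; exact: gate_eq0.
have dgate0 w l : ~~ discovered w u l -> dgate (corr w u l) = 0.
  by rewrite -ltNge => /ltW; exact: dgate_eq0.
rewrite /chain_grad; congr (_ - _); have [ki|ki] := eqVneq (block k) i.
  have predi : i.-1 != i by rewrite -(inj_eq succn_inj) prednK// ltn_eqF.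
  rewrite /slope ki !dgate0 ?disc1// !mul0r !addr0 -(corrE i.-1)//.
  have [di|di] := boolP (discovered w1 u i.-1); last by rewrite gate0// !mulr0.
  by rewrite noisy_i.
rewrite noisyE//; congr (_ * _ * _); rewrite /slope; congr (_ + _).
  have [pi|pi] := eqVneq (block k).-1 i; last by rewrite corrE.
  by rewrite pi !gate0 ?disc1.
(* The block before [i] sees the signs of [i] only in the correlation of its successor, multiplied
   by a derivative that vanishes unless this block is discovered. If it is, [i] is the frontier and
   only products of signs and coins enter. *)
rewrite -(corrE _ ki); have [ki1|ki1] := eqVneq (block k).+1 i.
  have [dk|dk] := boolP (discovered w1 u (block k)); last first.
    by rewrite dgate0// !mul0r.
  congr (_ * (_ + _)); apply: corr_eq_on => l lk; apply: noisy_i.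
    by rewrite -ki1.
  by rewrite lk.
by congr (_ * (_ + _)); apply: corr_eq_on => l lk; apply: noisyE; rewrite lk.
Qed.

End frontier.

(** * Differentials of functions given pointwise *)

Section differential.
Context {R : realType} {V : normedModType R}.
Implicit Types (f : V -> R) (x : V).

Lemma is_diff_fun_sum (I : Type) (s : seq I) (P : pred I) (f df : I -> V -> R) x :
    (forall i, is_diff x (f i) (df i)) ->
  is_diff x (fun y => \sum_(i <- s | P i) f i y)
    (fun h => \sum_(i <- s | P i) df i h).
Proof.
move=> fE; elim: s => [|i s IHs].
  have nilE (g : I -> V -> R) : (fun y => \sum_(j <- [::] | P j) g j y) = cst 0.
    by apply/funext => y; rewrite big_nil.
  by rewrite !nilE; exact: is_diff_cst.
have consE (g : I -> V -> R) : (fun y => \sum_(j <- i :: s | P j) g j y) =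
    (if P i then g i else cst 0) + (fun y => \sum_(j <- s | P j) g j y).
  by apply/funext => y; rewrite big_cons fctE; case: (P i); rewrite ?add0r.
rewrite !consE; apply: is_diffD; case: (P i) => //; exact: is_diff_cst.
Qed.

Lemma is_diff_fun_mul f g df dg x : is_diff x f df -> is_diff x g dg ->
  is_diff x (fun y => f y * g y) (fun h => f x * dg h + g x * df h).
Proof. by move=> fx gx; exact: is_diffM. Qed.

Lemma is_diff_fun_scale f df x (a : R) : is_diff x f df ->
  is_diff x (fun y => a * f y) (fun h => a * df h).
Proof. by move=> fx; exact: is_diffZ. Qed.

Lemma is_diff_fun_sub f g df dg x : is_diff x f df -> is_diff x g dg ->
  is_diff x (fun y => f y - g y) (fun h => df h - dg h).
Proof. by move=> fx gx; exact: is_diffB. Qed.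

Lemma is_diff_fun_addC f df x (a : R) : is_diff x f df ->
  is_diff x (fun y => f y + a) df.
Proof.
move=> fx; apply: (is_diff_eq (is_diffD fx (is_diff_cst a x))).
exact: addr0.
Qed.

Lemma is_diff_fun_comp f df x (g : R -> R) (g' : R) : is_diff x f df ->
  is_derive (f x) 1 g g' -> is_diff x (fun y => g (f y)) (fun h => g' * df h).
Proof.
move=> fx gx; have gd : differentiable g (f x).
  by apply/derivable1_diffP; exact: ex_derive.
have gdiff : is_diff (f x) g (fun h => h *: g').
  by apply: DiffDef => //; rewrite diff1E// derive1E derive_val.
apply: (is_diff_eq (is_diff_comp fx gdiff)).
by apply/funext => h /=; rewrite mulrC.
Qed.

End differential.

(** * The hard function and its gradient *)

Section hard_function.
Context {R : realType}.
Variables (T m : nat) (al kap : R).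
Hypotheses (m_gt0 : (0 < m)%N) (al_gt0 : 0 < al) (kap_gt0 : 0 < kap).
Local Notation d := (T * m)%N.
Local Notation block := (block m).
Local Notation corr := (@corr R T m).
Local Notation slope := (@slope R T m).
Local Notation chain_grad := (@chain_grad R T m).
Implicit Types (w : 'I_d -> R) (x h : 'rV[R]_d) (i : nat) (k : 'I_d).

Let mR_gt0 : 0 < m%:R :> R. Proof. by rewrite ltr0n. Qed.

Definition scaled x k : R := kap * x 0 k.

(** The scale of values is [al], that of lengths is the inverse of [kap]. The quadratic term has the
    normalisation 1/m of the correlations, so that both compete on equal terms in each
    coordinate. *)
Definition hard_fun w x : R :=
  al * ((2 * m%:R)^-1 * \sum_(k < d) scaled x k ^+ 2 - chain w (scaled x)).

Lemma is_diff_scaled x k : is_diff x (scaled^~ k) (scaled^~ k).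
Proof.
apply: is_diff_fun_scale; apply: DiffDef; first exact: differentiable_coord.
have @f : {linear 'rV[R]_d -> R}.
  by exists (fun y : 'rV[R]_d => y 0 k); do 2![eexists]; do ?[constructor];
     rewrite ?mxE// => ? *; rewrite ?mxE//; move=> ?; rewrite !mxE.
exact: (@diff_lin _ _ _ f x (@coord_continuous _ _ _ _ _)).
Qed.

Lemma is_diff_corr w x i : is_diff x (fun y => corr w (scaled y) i)
  (fun h => m%:R^-1 * \sum_(k < d | block k == i)
     w k * (tent 1 (scaled x k) * scaled h k)).
Proof.
have -> : (fun y => corr w (scaled y) i) =
    (fun y => m%:R^-1 * (\sum_(k < d | block k == i)
      w k * saturate (scaled y k)) + (i == 0%N)%:R).
  by apply/funext => y; rewrite [RHS]addrC.
apply: is_diff_fun_addC; apply: is_diff_fun_scale.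
apply: is_diff_fun_sum => k; apply: is_diff_fun_scale.
apply: (is_diff_fun_comp (g := saturate)); first exact: is_diff_scaled.
have := is_deriveB (is_derive_ramp 1 (scaled x k))
  (is_derive_cst (2^-1 : R) (scaled x k) 1).
by rewrite subr0.
Qed.

Lemma is_derive_gate (t : R) : is_derive t 1 gate (dgate t).
Proof.
have shift : is_derive t 1 (fun s : R => s - 3 / 16) 1.
  have := is_deriveB (is_derive_id t 1) (is_derive_cst (3 / 16 : R) t 1).
  by rewrite subr0.
have := @is_derive1_comp _ _ (fun s => s - 3 / 16) _ _ _
  (is_derive_ramp 16^-1 (t - 3 / 16)) shift.
by rewrite mulr1 => /(is_deriveZ (256 : R)).
Qed.

Let dcorr w x i h := m%:R^-1 * \sum_(k < d | block k == i)
     w k * (tent 1 (scaled x k) * scaled h k).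

Lemma is_diff_hard_fun w x : is_diff x (hard_fun w) (fun h =>
  al * ((2 * m%:R)^-1 * \sum_(k < d)
     (scaled x k * scaled h k + scaled x k * scaled h k) -
   \sum_(i < T.+1) (gate (corr w (scaled x) i) * dcorr w x i.+1 h +
     (corr w (scaled x) i.+1 + 2^-1) *
     (dgate (corr w (scaled x) i) * dcorr w x i h)))).
Proof.
apply: is_diff_fun_scale; apply: is_diff_fun_sub.
  apply: is_diff_fun_scale; apply: is_diff_fun_sum => k.
  by apply: is_diff_fun_mul; exact: is_diff_scaled.
apply: is_diff_fun_sum => i; apply: is_diff_fun_mul; last first.
  by apply: is_diff_fun_addC; exact: is_diff_corr.
apply: is_diff_fun_comp; last exact: is_derive_gate.
exact: is_diff_corr.
Qed.

Lemma gradient_hard_fun w x k :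
  gradient (hard_fun w) x 0 k =
  al * kap / m%:R * chain_grad w w (scaled x) k.
Proof.
have hx := is_diff_hard_fun w x.
rewrite mxE deriveE ?diff_val; last exact: ex_diff.
have scaled_delta l : scaled (delta_mx 0 k) l = if l == k then kap else 0.
  by rewrite /scaled mxE eqxx /=; case: eqP; rewrite ?mulr1 ?mulr0.
have dcorr_delta i : dcorr w x i (delta_mx 0 k) =
    if block k == i then m%:R^-1 * (w k * tent 1 (scaled x k) * kap) else 0.
  rewrite /dcorr; case: ifP => ki.
    rewrite (bigD1 k)//= big1 ?addr0 => [|l /andP[_ lk]].
      by rewrite scaled_delta eqxx !mulrA.
    by rewrite scaled_delta (negbTE lk) !mulr0.
  rewrite big1 ?mulr0// => l li; rewrite scaled_delta.
  by case: eqP => [lk|]; rewrite ?mulr0//; move: ki; rewrite -lk li.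
rewrite (bigD1 k)//= scaled_delta eqxx big1 ?addr0; last first.
  by move=> l lk; rewrite scaled_delta (negbTE lk) !mulr0 addr0.
have kT := block_le m_gt0 k.
(* Coordinate [k] occurs in two summands: at [(block k).-1], as part of the successor, and at
   [block k], through the gate. *)
rewrite big_split/= (bigD1 (Ordinal (ltnW kT : (block k).-1 < T.+1)%N))//=.
rewrite dcorr_delta eqxx big1 ?addr0 => [|i]; last first.
  rewrite -val_eqE/= => ik; rewrite dcorr_delta.
  by rewrite eqSS eq_sym (negbTE ik) mulr0.
rewrite (bigD1 (Ordinal (kT : (block k) < T.+1)%N))//=.
rewrite dcorr_delta eqxx big1 ?addr0 => [|i]; last first.
  rewrite -val_eqE/= => ik; rewrite dcorr_delta.
  by rewrite eq_sym (negbTE ik) !mulr0.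
rewrite /chain_grad /slope; field.
by rewrite gt_eqF.
Qed.

End hard_function.

(** * Finite laws and Borel maps *)

Section finite_laws.
Context {R : realType}.

Lemma finite_law_integral {disp : measure_display} {T : measurableType disp}
    (P : probability T R) (e : seq T) (p : T -> R) (f : T -> R) :
    uniq e -> (forall x, x \in e) -> (forall x : T, measurable [set x]) ->
    (forall x, P [set x] = (p x)%:E) ->
  P.-integrable setT (EFin \o f) /\
  (\int[P]_x (f x)%:E = (\sum_(x <- e) p x * f x)%:E)%E.
Proof.
move=> e_uniq e_all mT PE.
have fE : EFin \o f = fun y => (\sum_(x <- e) (f x)%:E * (\1_[set x] y)%:E)%E.
  apply/funext => y /=; rewrite (bigD1_seq y)//= indicE mem_set// mule1.
  rewrite big1 ?adde0// => x /eqP xy; rewrite indicE memNset ?mule0//=.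
  by move=> yx; apply: xy.
have intf x : P.-integrable setT (fun y => ((f x)%:E * (\1_[set x] y)%:E)%E).
  by apply: integrableZl => //; exact: integrable_indic.
split; first by rewrite fE; exact: integrable_sum.
rewrite -[X in integral _ _ X]/(EFin \o f) fE integral_sum// -sumEFin.
apply: eq_bigr => x _; rewrite integralZl//; last exact: integrable_indic.
transitivity ((f x)%:E * P [set x])%E; first by rewrite integral_indic// setIT.
by rewrite PE -EFinM mulrC.
Qed.

Lemma measurable_tuple_set1 {disp : measure_display} {T : measurableType disp} n :
  (forall x : T, measurable [set x]) ->
  forall t : n.-tuple T, measurable [set t].
Proof.
move=> mT t.
have -> : [set t] = \bigcap_(i in [set: 'I_n]) ((@tnth n T ^~ i) @^-1` [set tnth t i]).
  apply/seteqP; split => [_ -> i _//|s st].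
  by apply: eq_from_tnth => i; exact: st.
apply: fin_bigcap_measurable => // i _; rewrite -[X in measurable X]setTI.
exact: measurable_tnth.
Qed.

Lemma iid_law_set1 {disp : measure_display} {T : measurableType disp}
    (P : probability T R) (p : T -> R) n :
    (forall x : T, measurable [set x]) -> (forall x, P [set x] = (p x)%:E) ->
  forall t : n.-tuple T,
    iid_law P n [set t] = (\prod_(i < n) p (tnth t i))%:E.
Proof.
move=> mT PE; elim: n => [|n IHn] t.
  by rewrite big_ord0 /= diracE mem_set //= [RHS]tuple0.
pose s : n.-tuple T := [tuple tnth t (widen_ord (leqnSn n) i) | i < n].
have tE : t = tsnoc (s, tnth t ord_max).
  apply: eq_from_tnth => i; rewrite [RHS](tnth_nth (tnth t ord_max)) /=.
  rewrite nth_rcons size_map size_enum_ord.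
  case: (unliftP ord_max i) => [j|] ->; last by rewrite ltnn eqxx.
  rewrite lift_max ltn_ord (nth_map j) ?size_enum_ord// nth_ord_enum.
  by congr tnth; apply/val_inj; rewrite /= /bump leqNgt ltn_ord add0n.
have preE : @tsnoc _ T n @^-1` [set t] = [set s] `*` [set tnth t ord_max].
  apply/seteqP; split => [[s' x]|[s' x] [/= -> ->]]/=.
    rewrite {1}tE /tsnoc => /(congr1 val)/= /rcons_inj[ss ->].
    by split=> //; exact/val_inj.
  by rewrite [RHS]tE.
rewrite /= /distribution /pushforward preE product_measure1E//; last first.
  exact: measurable_tuple_set1.
transitivity (iid_law P n [set s] * P [set tnth t ord_max])%E; first by [].
rewrite IHn PE -EFinM big_ord_recr/=; congr (_ * _)%:E.
by apply: eq_bigr => i _; rewrite tnth_mktuple.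
Qed.
End finite_laws.

Section borel.
Context {R : realType}.

Lemma continuous_rV (X : topologicalType) (n : nat) (f : X -> 'rV[R]_n) :
  (forall i, continuous (fun x => f x 0 i)) -> continuous f.
Proof.
move=> fc x A [P nP PA].
have : \forall y \near x, forall i, P 0 i (f y 0 i).
  by apply: filter_forall => i; exact: (fc i x _ (nP 0 i)).
by apply: filterS => y Py; apply: PA => i j; rewrite ord1.
Qed.

Lemma continuous_borel_rV (n k : nat) (f : 'rV[R]_n -> 'rV[R]_k) :
  continuous f -> measurable_fun [set: borel_rV R n] (f : borel_rV R n -> borel_rV R k).
Proof.
move=> /continuousP fc; apply: measurability => // _ [B oB <-].
by rewrite setTI; apply: sub_sigma_algebra; exact: fc.
Qed.

Lemma continuous_borel_R (n : nat) (f : 'rV[R]_n -> R) :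
  continuous f -> measurable_fun [set: borel_rV R n] (f : borel_rV R n -> R).
Proof.
move=> /continuousP fc; apply: (measurability _ (measurable_realfun.RGenOpens.measurableE R)).
move=> _ [_ [a [b ->] <-]]; rewrite setTI; apply: sub_sigma_algebra.
by apply: fc; exact: interval_open.
Qed.

End borel.

Section finite_valued.
Context {d1 d2 : measure_display} {X : measurableType d1} {Y : measurableType d2}.

(** Meant for the oracle: its answer jumps with the set of discovered blocks, but is continuous in
    the point once this set and the coins are fixed. *)
Lemma measurable_finite_pieces (I : finType) (phi : X -> I) (g : I -> X -> Y) :
    (forall i, measurable (phi @^-1` [set i])) ->
    (forall i, measurable_fun [set: X] (g i)) ->
  measurable_fun [set: X] (fun x => g (phi x) x).
Proof.
move=> mphi mg _ B mB.
have -> : [set: X] `&` (fun x => g (phi x) x) @^-1` B =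
    \bigcup_(i in [set: I]) (phi @^-1` [set i] `&` ([set: X] `&` g i @^-1` B)).
  apply/seteqP; split => [x [_ Bx]|x [i _ [/= <- [_ Bx]]]]; last by split.
  by exists (phi x).
by apply: fin_bigcup_measurable => // i _; apply: measurableI => //; exact: mg.
Qed.

Lemma measurable_ffun_fiber (I : finType) (phi : X -> {ffun I -> bool}) :
    (forall i, measurable [set x | phi x i]) ->
  forall b, measurable (phi @^-1` [set b]).
Proof.
move=> mphi b.
have -> : phi @^-1` [set b] = \bigcap_(i in [set: I])
    (if b i then [set x | phi x i] else ~` [set x | phi x i]).
  apply/seteqP; split => [x /= <- i _|x xb]; first by case: ifP => /= [|->].
  apply/ffunP => i; have := xb i Logic.I; case: (b i) => //=.
  by move/negP/negbTE.
by apply: fin_bigcap_measurable => // i _; case: (b i) => //; exact: measurableC.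
Qed.

End finite_valued.

(** * The hard instances *)

Lemma sum_tuple_prod {R : comNzRingType} (F : finType) n (g : 'I_n -> F -> R) :
  \sum_(t : n.-tuple F) \prod_(i < n) g i (tnth t i) = \prod_(i < n) \sum_b g i b.
Proof.
rewrite bigA_distr_bigA (reindex (fun t : n.-tuple F => finfun (tnth t))).
  by apply: eq_bigr => t _; apply: eq_bigr => i _; rewrite ffunE.
exists (fun f : {ffun 'I_n -> F} => [tuple f i | i < n]) => t _.
  by apply: eq_from_tnth => i; rewrite tnth_mktuple ffunE.
by apply/ffunP => i; rewrite ffunE tnth_mktuple.
Qed.

Section coins.
Context {R : realType}.
Implicit Types (del : R) (b : bool).

Definition sg b : R := (-1) ^+ b.

Lemma sg_norm b : `|sg b| = 1. Proof. exact: normr_sign. Qed.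

Lemma sg_addb b c : sg (b (+) c) = sg b * sg c. Proof. exact: signr_addb. Qed.

Lemma sum_bool (f : bool -> R) : \sum_b f b = f true + f false.
Proof. by rewrite big_bool. Qed.

(* The law of a coin [b] for which the mean of [sg b] is [del]. *)
Definition coin del b : R := (1 + del * sg b) / 2.

Definition coins del n (z : n.-tuple bool) : R := \prod_(k < n) coin del (tnth z k).

Lemma coin_ge0 del b : 0 <= del <= 1 -> 0 <= coin del b.
Proof. by rewrite /coin /sg; case: b; rewrite ?expr1 ?expr0; lra. Qed.

Lemma sum_coin del : \sum_b coin del b = 1.
Proof. by rewrite sum_bool /coin /sg expr1 expr0; field. Qed.

Lemma sum_coins del n : \sum_(z : n.-tuple bool) coins del z = 1.
Proof.
rewrite (sum_tuple_prod (fun=> coin del)) big1// => k _; exact: sum_coin.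
Qed.

Lemma coins_mean del n (l : 'I_n) :
  \sum_(z : n.-tuple bool) coins del z * sg (tnth z l) = del.
Proof.
pose g (k : 'I_n) b := coin del b * (if k == l then sg b else 1).
transitivity (\sum_(z : n.-tuple bool) \prod_(k < n) g k (tnth z k)).
  apply: eq_bigr => z _; rewrite /g big_split/=; congr (_ * _).
  by rewrite -big_mkcond big_pred1_eq.
rewrite sum_tuple_prod (bigD1 l)//= [X in _ * X]big1 ?mulr1 => [|k /negbTE kl].
  by rewrite sum_bool /g eqxx /coin /sg expr1 expr0; field.
by rewrite /g kl; under eq_bigr do rewrite mulr1; exact: sum_coin.
Qed.

(** The parameter is the probability of [true], whose sign is -1. *)
Definition coin_law del : probability bool R := bernoulli_prob ((1 - del) / 2).

Lemma coin_law_set1 del b : 0 <= del <= 1 -> coin_law del [set b] = (coin del b)%:E.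
Proof.
move=> del01; transitivity (bernoulli_prob ((1 - del) / 2) [set b]); first by [].
rewrite bernoulli_probE; last by apply/andP; split; lra.
rewrite !diracE /coin /sg; case: b.
  rewrite mem_set// memNset// mule1 mule0 adde0 expr1; congr EFin; lra.
rewrite memNset// mem_set// mule1 mule0 add0e expr0; congr EFin.
by rewrite /unstable.onem; lra.
Qed.

Lemma coins_law_set1 del n (z : n.-tuple bool) : 0 <= del <= 1 ->
  iid_law (coin_law del) n [set z] = (coins del z)%:E.
Proof.
move=> del01; apply: iid_law_set1 => // b; exact: coin_law_set1.
Qed.

End coins.

Lemma enorm_scale {R : realType} n (y : 'rV[R]_n) (c : R) (f : 'I_n -> R) :
    0 <= c -> (forall i, y 0 i = c * f i) ->
  enorm y = c * Num.sqrt (\sum_(i < n) f i ^+ 2).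
Proof.
move=> c0 yE; rewrite /enorm; under eq_bigr do rewrite yE exprMn.
by rewrite -mulr_sumr sqrtrM ?sqr_ge0// sqrtr_sqr ger0_norm.
Qed.

Lemma lipschitz_continuousR {R : realType} (f : R -> R) (C : R) :
  (forall s t, `|f s - f t| <= C * `|s - t|) -> continuous f.
Proof.
move=> fC s; apply/cvgrPdist_le => e e0; near=> t.
have C1 : 0 < `|C| + 1 by rewrite ltr_wpDl.
have st : `|s - t| <= e / (`|C| + 1).
  by near: t; apply: cvgr_dist_le; rewrite ?divr_gt0//; exact: cvg_id.
apply: le_trans (fC s t) _; rewrite -[leRHS](divfK (lt0r_neq0 C1)) mulrC.
apply: le_trans (ler_wpM2l (normr_ge0 _) (ler_norm C)) _.
by rewrite ler_pM// lerDl.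
Unshelve. all: by end_near. Qed.

Section hard_instance.
Context {R : realType}.
Variables (T m : nat) (al kap del : R).
Hypotheses (m_gt0 : (0 < m)%N) (al_gt0 : 0 < al) (kap_gt0 : 0 < kap).
Hypothesis del01 : 0 < del <= 1.
Local Notation d := (T * m)%N.
Local Notation block := (block m).
Local Notation corr := (@corr R T m).
Local Notation chain_grad := (@chain_grad R T m).
Local Notation discovered := (@discovered R T m).
Local Notation frontier := (frontier T).
Local Notation scaled := (scaled kap).
Local Notation hard_fun := (hard_fun al kap).
Implicit Types (w u : 'I_d -> R) (x : 'rV[R]_d) (i : nat) (k : 'I_d).

Let mR_gt0 : 0 < m%:R :> R. Proof. by rewrite ltr0n. Qed.

Local Notation amp := (al * kap / m%:R).

Let amp_gt0 : 0 < amp. Proof. by rewrite divr_gt0 ?mulr_gt0. Qed.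

Definition signs (v : d.-tuple bool) k : R := sg (tnth v k).

Lemma signs_norm v k : `|signs v k| = 1. Proof. exact: sg_norm. Qed.

Let signs_le v k : `|signs v k| <= 1. Proof. by rewrite signs_norm. Qed.

Lemma continuous_chain_grad w w' k :
  continuous (fun x => chain_grad w w' (scaled x) k).
Proof.
have csc (l : 'I_d) : continuous (scaled^~ l).
  move=> x; have hx := is_diff_scaled kap x l.
  exact: differentiable_continuous (@ex_diff _ _ _ _ _ _ _ hx).
have ctent (l : 'I_d) : continuous (fun x => tent 1 (scaled x l)).
  move=> x; apply: (@continuous_comp _ _ _ (scaled^~ l) (tent 1)); first exact: csc.
  exact: (lipschitz_continuousR (tent_lipschitz 1)).
have ccorr w0 i : continuous (fun x => corr w0 (scaled x) i).
  move=> x; have hx := is_diff_corr kap w0 x i.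
  exact: differentiable_continuous (@ex_diff _ _ _ _ _ _ _ hx).
have cB (f g : 'rV[R]_d -> R) : continuous f -> continuous g ->
    continuous (fun x => f x - g x).
  by move=> cf cg x; exact: (continuousB (cf x) (cg x)).
have cD (f g : 'rV[R]_d -> R) : continuous f -> continuous g ->
    continuous (fun x => f x + g x).
  by move=> cf cg x; exact: (continuousD (cf x) (cg x)).
have cM (f g : 'rV[R]_d -> R) : continuous f -> continuous g ->
    continuous (fun x => f x * g x).
  by move=> cf cg x; exact: (continuousM (cf x) (cg x)).
have cC (a : R) : continuous (fun x : 'rV[R]_d => a) by exact: cst_continuous.
have cgate i : continuous (fun x => gate (corr w (scaled x) i)).
  move=> x; apply: (@continuous_comp _ _ _ (fun x => corr w (scaled x) i) gate).
    exact: ccorr.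
  exact: (lipschitz_continuousR (@gate_lipschitz R)).
have cdgate i : continuous (fun x => dgate (corr w (scaled x) i)).
  move=> x; apply: (@continuous_comp _ _ _ (fun x => corr w (scaled x) i) dgate).
    exact: ccorr.
  exact: (lipschitz_continuousR (@dgate_lipschitz R)).
exact: (cB _ _ (csc k) (cM _ _ (cM _ _ (cC (w' k)) (ctent k)) (cD _ _
  (cgate (block k).-1)
  (cM _ _ (cdgate (block k)) (cD _ _ (ccorr w' (block k).+1) (cC 2^-1)))))).
Qed.

Lemma smooth_class_hard_fun v (Delta L : R) :
    al * T%:R <= Delta -> amp * kap * 2 ^+ 12 <= L ->
  smooth_class Delta L (hard_fun (signs v)).
Proof.
move=> alT ampL; set F := hard_fun _.
have Fdiff x : differentiable F x.
  by have hx := is_diff_hard_fun al kap (signs v) x; exact: ex_diff.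
have chain_b u := chain_bounds m_gt0 u (signs_le v).
have F_ge x : - (al * (T%:R + 2^-1)) <= F x.
  rewrite /F /hard_fun -mulrN ler_wpM2l ?(ltW al_gt0)//.
  have /andP[_ cT] := chain_b (scaled x).
  have : 0 <= (2 * m%:R)^-1 * \sum_(k < d) scaled x k ^+ 2.
    by rewrite mulr_ge0 ?invr_ge0 ?mulr_ge0// sumr_ge0// => k _; exact: sqr_ge0.
  lra.
have F0 : F 0 = - (al / 2).
  rewrite /F /hard_fun (_ : scaled 0 = fun=> 0); last first.
    by apply/funext => k; rewrite /scaled mxE mulr0.
  by rewrite chain0 big1 ?mulr0 ?sub0r ?mulrN// => k _; rewrite expr0n.
split.
- split => //; apply: continuous_rV => k.
  have -> : (fun x => gradient F x 0 k) =
      (fun x => amp * chain_grad (signs v) (signs v) (scaled x) k).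
    by apply/funext => x; exact: gradient_hard_fun.
  move=> x; exact: (continuousM (@cst_continuous _ _ amp x)
    (@continuous_chain_grad (signs v) (signs v) k x)).
- by exists (- (al * (T%:R + 2^-1))) => _ [x _ <-].
- have : - (al * (T%:R + 2^-1)) <= inf (range F).
    by apply: lb_le_inf; [exists (F 0), 0|move=> _ [x _ <-]].
  by rewrite F0; lra.
- move=> x y; pose g u k := chain_grad (signs v) (signs v) u k.
  rewrite (enorm_scale (c := amp) (f := fun k => g (scaled x) k - g (scaled y) k)).
  + rewrite (enorm_scale (y := x - y) (c := kap^-1)
      (f := fun k => scaled x k - scaled y k)) ?invr_ge0 ?(ltW kap_gt0)//.
      set S := \sum_(k < d) _; set S' := \sum_(k < d) _.
      have SS' : S <= (2 ^+ 12) ^+ 2 * S'.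
        by rewrite -exprM; exact: chain_grad_lipschitz (signs_le v).
      have : Num.sqrt S <= 2 ^+ 12 * Num.sqrt S'.
        apply: le_trans (ler_wsqrtr SS') _.
        by rewrite sqrtrM ?sqr_ge0// sqrtr_sqr ger0_norm ?exprn_ge0.
      rewrite mulrA => /(ler_wpM2l (ltW amp_gt0)) /le_trans; apply.
      rewrite mulrA ler_wpM2r ?sqrtr_ge0//.
      by rewrite ler_pdivlMr// mulrAC.
    by move=> k; rewrite /scaled !mxE -mulrBr mulKf// gt_eqF.
  + exact: ltW.
  + by move=> k; rewrite mxE [X in _ + X]mxE !gradient_hard_fun// -mulrBr.
Qed.

Definition hard_answer v (p : borel_rV R d * d.-tuple bool) : borel_rV R d :=
  \row_(k < d) (amp * chain_grad (signs v)
    (noisy del (signs v) (signs p.2) (scaled p.1)) (scaled p.1) k).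

(** Beyond [T] the correlations vanish and nothing is discovered, which makes [false] the right
    extension. *)
Let fill (b : {ffun 'I_T.+1 -> bool}) i : bool :=
  if insub i is Some l then b l else false.

Lemma measurable_hard_answer v :
  measurable_fun [set: borel_rV R d * d.-tuple bool] (hard_answer v).
Proof.
pose I := ({ffun 'I_T.+1 -> bool} * d.-tuple bool)%type.
pose phi (p : borel_rV R d * d.-tuple bool) : I :=
  ([ffun l : 'I_T.+1 => discovered (signs v) (scaled p.1) l], p.2).
pose g (i : I) (p : borel_rV R d * d.-tuple bool) : borel_rV R d :=
  \row_(k < d) (amp * chain_grad (signs v) (fun k => if frontier (fill i.1) (block k)
    then signs v k * signs i.2 k / del else signs v k) (scaled p.1) k).
have -> : hard_answer v = fun p => g (phi p) p.
  apply/funext => p; apply/rowP => k; rewrite !mxE; congr (_ * chain_grad _ _ _ _).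
  apply/funext => l; rewrite /noisy; congr (if _ then _ else _).
  congr frontier; apply/funext => i; rewrite /fill /=.
  case: insubP => [j _ <-|]; first by rewrite ffunE.
  rewrite ltnS -ltnNge /discovered => Ti.
  by rewrite (corr_large m_gt0 _ _ Ti) leNgt invr_gt0 ltr0n.
apply: measurable_finite_pieces => [[b z]|i].
  have -> : phi @^-1` [set (b, z)] =
      ((fun x : borel_rV R d => [ffun l : 'I_T.+1 => discovered (signs v) (scaled x) l])
        @^-1` [set b]) `*` [set z].
    by apply/seteqP; split => [[x y] [<- <-]|[x y] [/= <- <-]].
  apply: measurableX; last exact: measurable_tuple_set1.
  apply: measurable_ffun_fiber => l.
  rewrite (_ : [set x | _] = ~` [set x | corr (signs v) (scaled x) l < 8^-1]); last first.
    by apply/seteqP; split => x /=; rewrite ffunE /discovered leNgt => /negP.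
  apply: measurableC; apply: sub_sigma_algebra.
  have corr_cont : continuous (fun x => corr (signs v) (scaled x) l).
    move=> x; have hx := is_diff_corr kap (signs v) x l.
    exact: differentiable_continuous (@ex_diff _ _ _ _ _ _ _ hx).
  have /continuousP/(_ `]-oo, 8^-1[%classic) := corr_cont.
  rewrite (_ : _ @^-1` _ = [set x | corr (signs v) (scaled x) l < 8^-1]).
    by apply; exact: interval_open.
  by apply/seteqP; split => x /=; rewrite in_itv.
pose f (x : 'rV[R]_d) : 'rV[R]_d := g i (x, i.2).
apply: (measurableT_comp (f := f : borel_rV R d -> borel_rV R d)) => //.
apply: continuous_borel_rV; apply: continuous_rV => k; rewrite /f /g.
under eq_fun do rewrite mxE.
move=> x; exact: (continuousM (@cst_continuous _ _ amp x)
  (@continuous_chain_grad (signs v) _ k x)).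
Qed.

Definition hard_oracle v : oracle R d :=
  @Oracle R d _ _ (iid_law (coin_law del) d) (hard_answer v)
    (measurable_hard_answer v).

Let del01' : 0 <= del <= 1. Proof. by case/andP: del01 => /ltW -> ->. Qed.

Lemma unbiased_hard_oracle v : unbiased (hard_fun (signs v)) (hard_oracle v).
Proof.
move=> x k; pose f (z : d.-tuple bool) : R :=
  amp * chain_grad (signs v) (noisy del (signs v) (signs z) (scaled x)) (scaled x) k.
have fE : (fun z => (hard_answer v (x, z) : 'rV[R]_d) 0 k) = f.
  by apply/funext => z; rewrite mxE.
have mz (z : d.-tuple bool) : measurable [set z] by exact: measurable_tuple_set1.
have [intf fsum] := @finite_law_integral R _ _ (iid_law (coin_law del) d)
  (enum {: d.-tuple bool}) (@coins R del d) f (enum_uniq _)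
  (fun z => mem_enum _ z) mz
  (fun z => coins_law_set1 z del01').
split; first by move: intf; rewrite -fE.
rewrite unlock.
transitivity (\int[iid_law (coin_law del) d]_z (f z)%:E)%E; first by rewrite -fE.
rewrite fsum gradient_hard_fun// big_enum/=; congr EFin.
under eq_bigr do rewrite mulrCA; rewrite -mulr_sumr; congr (_ * _).
apply: chain_grad_unbiased => //; first by case/andP: del01 => /lt0r_neq0.
- exact: sum_coins.
- exact: coins_mean.
Qed.

Lemma bounded_noise_hard_oracle v (sigma : R) :
    38 * (al * kap) <= sigma * (del * Num.sqrt m%:R) ->
  bounded_noise sigma (hard_fun (signs v)) (hard_oracle v).
Proof.
move=> ampS; exists setT; split => //; first exact: probability_setT.
move=> x z _.
rewrite (enorm_scale (c := amp) (f := fun k => chain_grad (signs v)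
  (noisy del (signs v) (signs z) (scaled x)) (scaled x) k -
  chain_grad (signs v) (signs v) (scaled x) k)); last 2 first.
- exact: ltW.
- by move=> k; rewrite mxE [X in _ + X]mxE mxE gradient_hard_fun// -mulrBr.
have /andP[del0 _] := del01.
have := noise_le m_gt0 (scaled x) del01 (signs_le v) (signs_le z).
move=> /ler_wsqrtr/(ler_wpM2l (ltW amp_gt0))/le_trans; apply.
rewrite sqrtrM ?ler0n// sqrtr_sqr ger0_norm; last first.
  by rewrite divr_ge0 ?ler0n ?(ltW del0).
move: ampS; have sm : 0 < Num.sqrt m%:R :> R by rewrite sqrtr_gt0.
have -> : m%:R = Num.sqrt m%:R ^+ 2 :> R by rewrite sqr_sqrtr ?ler0n.
rewrite sqrtr_sqr gtr0_norm//; move: (Num.sqrt m%:R) sm => s s0 ampS.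
rewrite [leLHS](_ : _ = (38 * (al * kap)) / (del * s)); last first.
  by field; rewrite !gt_eqF.
by rewrite ler_pdivrMr ?mulr_gt0.
Qed.

(** Block [i] itself may follow a closed gate. The least positive [j] with correlation at most 1/4
    is not beyond [i], and the gate before it is fully open. *)
Lemma gradient_hard_fun_large v x i (G : R) : 0 <= G ->
    G * (8 * Num.sqrt m%:R) <= al * kap ->
    (0 < i <= T)%N -> ~~ discovered (signs v) (scaled x) i ->
  G <= enorm (gradient (hard_fun (signs v)) x).
Proof.
move=> G0 Gamp; set u := scaled x; set w := signs v => /andP[i0 iT] ui.
have low : exists j, (0 < j)%N && (corr w u j <= 4^-1).
  by exists i; rewrite i0 (le_trans (ltW _) (_ : 8^-1 <= _)) ?ltNge//; lra.
case: (ex_minnP low) => j /andP[j0 uj] j_min.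
have jT : (0 < j <= T)%N.
  rewrite j0 (leq_trans _ iT) ?j_min// i0 (le_trans (ltW _) (_ : 8^-1 <= _)) ?ltNge//.
  lra.
have prev : 4^-1 <= corr w u j.-1.
  rewrite leNgt; apply/negP => /ltW uj1.
  case: j j0 {uj jT} j_min uj1 => // -[|j] _ j_min /=; first by rewrite corr0; lra.
  by move=> uj1; have := j_min j.+1; rewrite uj1 ltnn => /(_ isT).
rewrite (enorm_scale (c := amp) (f := chain_grad w w u)); last 2 first.
- exact: ltW.
- by move=> k; exact: gradient_hard_fun.
have := chain_grad_large m_gt0 (signs_norm v) jT prev uj.
move=> /ler_wsqrtr/(ler_wpM2l (ltW amp_gt0)); apply: le_trans.
move: Gamp; have sm : 0 < Num.sqrt m%:R :> R by rewrite sqrtr_gt0.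
have -> : Num.sqrt (m%:R / 64) = Num.sqrt m%:R / 8 :> R.
  rewrite sqrtrM ?ler0n//; congr (_ * _).
  by rewrite (_ : 64^-1 = 8^-1 ^+ 2) ?sqrtr_sqr ?ger0_norm ?invr_ge0 ?ler0n//; lra.
have -> : m%:R = Num.sqrt m%:R ^+ 2 :> R by rewrite sqr_sqrtr ?ler0n.
rewrite sqrtr_sqr gtr0_norm//; move: (Num.sqrt m%:R) sm => s s0 Gamp.
rewrite [leRHS](_ : _ = al * kap / (8 * s)); last by field; rewrite gt_eqF.
by rewrite ler_pdivlMr// mulr_gt0.
Qed.

End hard_instance.

(** * The probability of discovering a block *)

Section flips.
Context {R : realType}.
Variables (T m K : nat).
Hypotheses (m_gt0 : (0 < m)%N) (K_gt0 : (0 < K)%N).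
Local Notation d := (T * m)%N.
Local Notation signs := (@signs R T m).
Local Notation discovered := (@discovered R T m).
Implicit Types (v c : d.-tuple bool) (i : nat) (k : 'I_d).

Definition flip i c v : d.-tuple bool :=
  [tuple tnth v k (+) ((block m k == i) && tnth c k) | k < d].

Lemma flipK i c : involutive (flip i c).
Proof.
by move=> v; apply: eq_from_tnth => k; rewrite !tnth_mktuple addbK.
Qed.

(** Companion of [flip]: in window [i], the products of the signs and the coins of block [i] are the
    same after both flips. *)
Definition flips n i c (z : n.-tuple (d.-tuple bool)) : n.-tuple (d.-tuple bool) :=
  [tuple if block K s == i then flip i c (tnth z s) else tnth z s | s < n].

Lemma flipsK n i c : involutive (@flips n i c).
Proof.
move=> z; apply: eq_from_tnth => s; rewrite !tnth_mktuple.
by case: (block K s == i); rewrite ?flipK.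
Qed.

(* [exp y + exp (- y) <= 2 / (1 - y ^+ 2)], since [exp (- y) >= 1 - y]. *)
Lemma expR_sym_le (y : R) : `|y| <= 10^-1 -> expR y + expR (- y) <= 2 * expR 80^-1.
Proof.
rewrite ler_norml => /andP[y1 y2].
have expV (t : R) : -10^-1 <= t <= 10^-1 -> expR t <= (1 - t)^-1.
  move=> t1; have := expR_ge1Dx (- t); rewrite expRN => h.
  by rewrite -[leLHS]invrK lef_pV2 ?posrE ?invr_gt0 ?expR_gt0//; lra.
have := expV y; have := expV (- y); rewrite opprK.
have := expR_ge1Dx (80^-1 : R).
have -> : (1 + y)^-1 = 2 / (1 - y ^+ 2) - (1 - y)^-1.
  by field; rewrite !gt_eqF//; nra.
have : 2 / (1 - y ^+ 2) <= 2 * (100 / 99).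
  rewrite ler_pM2l// -[leRHS]invrK lef_pV2 ?posrE; last 2 first.
  - by nra.
  - by lra.
  by rewrite invf_div; nra.
lra.
Qed.

(** Exponential Markov inequality with parameter 1/5. Discovery means a sum of at least m/8, which
    gains exp(-m/40), and each random sign costs at most exp(1/80) because its exponent is at most
    1/10 in absolute value. *)
Lemma chernoff v (u : 'I_d -> R) i : (0 < i)%N ->
  \sum_c (discovered (signs (flip i c v)) u i)%:R <=
    2 ^+ d * expR (- (m%:R / 80)) :> R.
Proof.
case: i => // i _; pose a k := signs v k * saturate (u k).
have aB k : `|a k / 5| <= 10^-1.
  by rewrite !normrM signs_norm mul1r; have := saturate_norm_le (u k);
    rewrite [`|5^-1|]ger0_norm ?invr_ge0 ?ler0n//; lra.
pose g k (b : bool) : R := if block m k == i.+1 then expR (sg b * (a k / 5)) else 1.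
have le_g c : (discovered (signs (flip i.+1 c v)) u i.+1)%:R <=
    expR (- (m%:R / 40)) * \prod_(k < d) g k (tnth c k).
  have gE : \prod_(k < d) g k (tnth c k) =
      expR (\sum_(k < d | block m k == i.+1) sg (tnth c k) * (a k / 5)).
    by rewrite expR_sum [RHS]big_mkcond.
  rewrite gE -expRD; case: (boolP (discovered _ _ _)); last by rewrite expR_ge0.
  rewrite /discovered corrS ler_pdivlMl ?ltr0n// => disc.
  rewrite -[leLHS]expR0 ler_expR.
  have -> : \sum_(k < d | block m k == i.+1) sg (tnth c k) * (a k / 5) =
    (\sum_(k < d | block m k == i.+1) signs (flip i.+1 c v) k * saturate (u k)) / 5.
    rewrite mulr_suml; apply: eq_bigr => k ki.
    by rewrite /signs /flip tnth_mktuple ki sg_addb /a /signs; ring.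
  lra.
apply: le_trans (ler_sum _ (fun c _ => le_g c)) _.
rewrite -mulr_sumr sum_tuple_prod.
have gsum k : \sum_b g k b <= 2 * (if block m k == i.+1 then expR 80^-1 else 1).
  rewrite sum_bool /g; case: ifP => _; last by lra.
  by rewrite /sg expr1 expr0 mul1r mulN1r addrC expR_sym_le.
have : \prod_(k < d) \sum_b g k b <=
    \prod_(k < d) (2 * (if block m k == i.+1 then expR 80^-1 else 1)).
  apply: ler_prod => k _; rewrite gsum andbT.
  by apply: sumr_ge0 => b _; rewrite /g; case: ifP => // _; exact: expR_ge0.
rewrite big_split/= prodr_const card_ord -big_mkcond/= prodr_const => prod_le.
apply: le_trans (ler_wpM2l (expR_ge0 _) prod_le) _.
rewrite mulrCA ler_wpM2l ?exprn_ge0// -expRM_natl -expRD ler_expR.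
have : #|[pred k : 'I_d | block m k == i.+1]|%:R <= m%:R :> R.
  by rewrite ler_nat card_block_le.
lra.
Qed.

Variable del : R.
Hypothesis del01 : 0 <= del <= 1.

Section likelihood.
Variables (n i : nat).
Implicit Types (z : n.-tuple (d.-tuple bool)) (s : 'I_n).

Definition sample_weight z : R := \prod_(s < n) coins del (tnth z s).

Local Notation hidden s k := ((block K s == i) && (block m k == i)).

(* The law of the samples under which the coins that act on block [i] during its
   time window are fair, and the likelihood ratio of the true law to it. *)
Definition null_weight z : R := \prod_(s < n) \prod_(k < d)
  (if hidden s k then 2^-1 else coin del (tnth (tnth z s) k)).

Definition likelihood_ratio z : R := \prod_(s < n) \prod_(k < d)
  (if hidden s k then 1 + del * sg (tnth (tnth z s) k) else 1).

Lemma sample_weightE z : sample_weight z = null_weight z * likelihood_ratio z.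
Proof.
rewrite -big_split/=; apply: eq_bigr => s _; rewrite -big_split/=.
apply: eq_bigr => k _; case: ifP => _; last by rewrite mulr1.
by rewrite /coin mulrC.
Qed.

Lemma null_weight_ge0 z : 0 <= null_weight z.
Proof.
apply: prodr_ge0 => s _; apply: prodr_ge0 => k _; case: ifP => _ //.
exact: coin_ge0.
Qed.

Lemma null_weight_flips c z : null_weight (flips i c z) = null_weight z.
Proof.
apply: eq_bigr => s _; apply: eq_bigr => k _; case: ifP => // /negbT.
rewrite negb_and tnth_mktuple; case: (block K s == i) => //= /negbTE ki.
by rewrite tnth_mktuple ki addbF.
Qed.

Let sum_prod (g : 'I_n -> 'I_d -> bool -> R) :
  \sum_z \prod_(s < n) \prod_(k < d) g s k (tnth (tnth z s) k) =
  \prod_(s < n) \prod_(k < d) \sum_b g s k b.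
Proof.
rewrite (sum_tuple_prod (fun s x => \prod_(k < d) g s k (tnth x k))).
by apply: eq_bigr => s _; exact: sum_tuple_prod.
Qed.

Lemma sum_null_weight : \sum_z null_weight z = 1.
Proof.
rewrite (sum_prod (fun s k b => if hidden s k then 2^-1 else coin del b)).
rewrite big1// => s _; rewrite big1// => k _; case: (hidden s k).
  by rewrite sum_bool; field.
exact: sum_coin.
Qed.

(** The last window may be incomplete; embedding ['I_n] into ['I_(n * K)] reduces to full blocks. *)
Lemma card_window : (#|[pred s : 'I_n | block K s == i]| <= K)%N.
Proof.
apply: leq_trans (card_block_le n K_gt0 i).
pose f := widen_ord (leq_pmulr n K_gt0).
have f_inj : injective f by move=> s t /(congr1 val)/= /val_inj.
rewrite -(fintype.card_image f_inj).
by apply: subset_leq_card; apply/fintype.subsetP => _ /fintype.imageP[s si ->].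
Qed.

(** Each hidden coin contributes a factor [1 + del ^+ 2], the second moment of its ratio under a
    fair coin, and at most [K * m] coins are hidden. *)
Lemma second_moment : \sum_z null_weight z * likelihood_ratio z ^+ 2 <=
  expR (del ^+ 2 * (K * m)%:R).
Proof.
pose g (s : 'I_n) (k : 'I_d) b : R := if hidden s k then
  2^-1 * (1 + del * sg b) ^+ 2 else coin del b.
have -> : \sum_z null_weight z * likelihood_ratio z ^+ 2 =
    \sum_z \prod_(s < n) \prod_(k < d) g s k (tnth (tnth z s) k).
  apply: eq_bigr => z _; rewrite expr2 -!big_split/=; apply: eq_bigr => s _.
  rewrite -!big_split/=; apply: eq_bigr => k _; rewrite /g.
  by case: ifP => _; rewrite ?mulr1// expr2.
rewrite sum_prod.
have gE s k : \sum_b g s k b = if hidden s k then 1 + del ^+ 2 else 1.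
  rewrite /g; case: (hidden s k); last exact: sum_coin.
  by rewrite sum_bool /sg expr1 expr0; field.
have d1 : 1 <= 1 + del ^+ 2 by rewrite lerDl sqr_ge0.
have inner s : \prod_(k < d) \sum_b g s k b <=
    if block K s == i then (1 + del ^+ 2) ^+ m else 1.
  under eq_bigr do rewrite gE.
  case: (block K s == i); last by rewrite big1.
  by rewrite -big_mkcond/= prodr_const ler_weXn2l ?card_block_le.
apply: le_trans (_ : \prod_(s < n)
    (if block K s == i then (1 + del ^+ 2) ^+ m else 1) <= _).
  apply: ler_prod => s _; rewrite inner andbT; apply: prodr_ge0 => k _.
  by rewrite gE; case: ifP => _ //; lra.
rewrite -big_mkcond/= prodr_const -exprM.
apply: le_trans (_ : (1 + del ^+ 2) ^+ (m * K) <= _).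
  by rewrite ler_weXn2l// leq_mul2l card_window orbT.
rewrite mulnC mulrC expRM_natl; apply: lerXn2r; rewrite ?nnegrE ?expR_ge0//.
  exact: le_trans d1.
exact: expR_ge1Dx.
Qed.

End likelihood.

(* The bound on the probability of [E] comes from averaging over the flips [c],
   under which the law of [(v, z)] changes only by a likelihood ratio, and from
   [2 r <= a r ^+ 2 + a^-1], which separates this ratio from the event. *)
Lemma flip_average n i (E : d.-tuple bool -> n.-tuple (d.-tuple bool) -> bool) :
    (0 < i)%N -> del ^+ 2 * K%:R <= 512^-1 ->
    (forall v z, exists u : 'I_d -> R, forall c,
      E (flip i c v) (flips i c z) -> discovered (signs (flip i c v)) u i) ->
  \sum_v \sum_z sample_weight z * (E v z)%:R <= 2 ^+ d * expR (- (m%:R / 256)).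
Proof.
move=> i0 delK sel; pose N : R := 2 ^+ d.
have N0 : 0 < N by rewrite exprn_gt0.
have cardE : \sum_(v : d.-tuple bool) 1 = N :> R.
  by rewrite sumr_const card_tuple card_bool natrX.
have sum_cst (a : R) : \sum_(v : d.-tuple bool) a = N * a.
  by rewrite -cardE mulr_suml; under [RHS]eq_bigr do rewrite mul1r.
pose u v z := sval (cid (sel v z)).
have uP v z c : E (flip i c v) (flips i c z) ->
    discovered (signs (flip i c v)) (u v z) i.
  exact: (svalP (cid (sel v z)) c).
pose D c v z : R := (discovered (signs (flip i c v)) (u v z) i)%:R.
pose lr := @likelihood_ratio n i; pose nw := @null_weight n i.
(* This value balances the two terms: the exponents -1/160 + 1/512 of the ratio and 1/160 - 1/80 of
   the discovery are both below -1/256. *)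
pose a : R := expR (- (m%:R / 160)).
have a0 : 0 < a by exact: expR_gt0.
(* For fixed [c] the flips permute the pairs, so the sum can be averaged over [c]. The null weight
   is invariant, which leaves the ratio, handled by undoing the flip, and the event, handled by
   Chernoff at a point independent of [c]. *)
have average : N * (\sum_v \sum_z sample_weight z * (E v z)%:R) =
    \sum_c \sum_v \sum_z
      sample_weight (flips i c z) * (E (flip i c v) (flips i c z))%:R.
  rewrite -sum_cst; apply: eq_bigr => c _.
  rewrite (reindex_inj (inv_inj (flipK i c))); apply: eq_bigr => v _.
  by rewrite (reindex_inj (inv_inj (@flipsK n i c))).
have pointwise c v z :
    sample_weight (flips i c z) * (E (flip i c v) (flips i c z))%:R <=
    2^-1 * (a * (nw (flips i c z) * lr (flips i c z) ^+ 2)) +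
    2^-1 * (a^-1 * (nw z * D c v z)).
  rewrite (sample_weightE i) -/(nw _) -/(lr _) [nw (flips i c z)]null_weight_flips.
  have nw0 : 0 <= nw z by exact: null_weight_ge0.
  have aV0 : 0 <= a^-1 by rewrite invr_ge0 ltW.
  move: (lr _) => r.
  have D0 : 0 <= D c v z by rewrite /D ler0n.
  case: (boolP (E _ _)) => [/uP disc|_]; last first.
    rewrite mulr0; apply: addr_ge0; apply: mulr_ge0; rewrite ?invr_ge0 ?ler0n//.
      by apply: mulr_ge0; [exact: ltW|apply: mulr_ge0 => //; exact: sqr_ge0].
    by apply: mulr_ge0 => //; exact: mulr_ge0.
  rewrite /D disc !mulr1.
  have amgm : 2 * r <= a * r ^+ 2 + a^-1.
    rewrite -subr_ge0 (_ : _ - _ = a^-1 * (a * r - 1) ^+ 2).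
      by rewrite mulr_ge0 ?sqr_ge0.
    by field; rewrite gt_eqF.
  by have := ler_wpM2l nw0 amgm; rewrite -/(nw z); lra.
have sum_lr : \sum_c \sum_(v : d.-tuple bool) \sum_z
    nw (flips i c z) * lr (flips i c z) ^+ 2 <=
    N * (N * expR (del ^+ 2 * (K * m)%:R)).
  rewrite -(sum_cst (N * _)); apply: ler_sum => c _; rewrite sum_cst.
  rewrite ler_wpM2l ?(ltW N0)//; apply: le_trans (second_moment n i).
  by rewrite [leRHS](reindex_inj (inv_inj (@flipsK n i c))).
have sum_D : \sum_c \sum_v \sum_z nw z * D c v z <=
    N * (N * expR (- (m%:R / 80))).
  rewrite exchange_big/= -(sum_cst (N * _)); apply: ler_sum => v _.
  rewrite exchange_big/=; under eq_bigr do rewrite -mulr_sumr.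
  have -> : N * expR (- (m%:R / 80)) =
      \sum_z nw z * (N * expR (- (m%:R / 80))).
    by rewrite -mulr_suml sum_null_weight mul1r.
  apply: ler_sum => z _; rewrite ler_wpM2l ?null_weight_ge0//.
  exact: chernoff.
rewrite -(ler_pM2l N0) average.
apply: le_trans (_ : 2^-1 * (a * (N * (N * expR (del ^+ 2 * (K * m)%:R)))) +
    2^-1 * (a^-1 * (N * (N * expR (- (m%:R / 80))))) <= _).
  apply: le_trans (_ : \sum_c \sum_v \sum_z
    (2^-1 * (a * (nw (flips i c z) * lr (flips i c z) ^+ 2)) +
    2^-1 * (a^-1 * (nw z * D c v z))) <= _).
    by apply: ler_sum => c _; apply: ler_sum => v _; apply: ler_sum => z _.
  under eq_bigr => c _ do under eq_bigr => v _ do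
    rewrite big_split/= -!mulr_sumr.
  under eq_bigr => c _ do rewrite big_split/= -!mulr_sumr.
  rewrite big_split/= -!mulr_sumr lerD// ler_wpM2l ?invr_ge0 ?ler0n//.
    by rewrite ler_wpM2l// ltW.
  by rewrite ler_wpM2l// invr_ge0 ltW.
have e1 : a * expR (del ^+ 2 * (K * m)%:R) <= expR (- (m%:R / 256)).
  rewrite -expRD ler_expR natrM.
  by have := ler_wpM2r (ler0n R m) delK; have := ler0n R m; lra.
have e2 : a^-1 * expR (- (m%:R / 80)) <= expR (- (m%:R / 256)).
  by rewrite -expRN -expRD ler_expR; have := ler0n R m; lra.
have NN : 0 <= N * N by rewrite mulr_ge0 ?ltW.
by have := ler_wpM2l NN e1; have := ler_wpM2l NN e2; rewrite -/N; lra.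
Qed.

End flips.

(** * Transcripts and the induction over the queries *)

Section transcript.
Context {R : realType}.
Variables (T m K : nat) (al kap del : R).
Hypotheses (m_gt0 : (0 < m)%N) (K_gt0 : (0 < K)%N).
Hypothesis del01 : 0 < del <= 1.
Local Notation d := (T * m)%N.
Variables (n : nat) (A : algorithm R d n) (u : seed A).
Implicit Types (v : d.-tuple bool) (zs : nat -> d.-tuple bool) (t s i l : nat).

(** The samples form a sequence indexed by [nat], so that transcripts of different lengths share
    them without casts. *)
Definition transcript v zs t : t.-tuple (borel_rV R d) :=
  @responses R d n A (hard_oracle al kap del m_gt0 v) u t [tuple zs s | s < t].

Definition query_point v zs t : 'rV[R]_d := query A (u, transcript v zs t).

Lemma transcriptS v zs t : transcript v zs t.+1 =
  [tuple of rcons (transcript v zs t)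
    (hard_answer al kap del v (query_point v zs t, zs t))].
Proof.
rewrite /transcript /=; apply/val_inj => /=.
rewrite (_ : [tuple tnth _ _ | i < t] = [tuple zs s | s < t]); last first.
  by apply: eq_from_tnth => s; rewrite !tnth_mktuple.
by rewrite tnth_mktuple.
Qed.

(* Time is divided into windows of [K] queries, numbered like the blocks: no
   block should be discovered before the end of the window of the same number. *)
Definition unexplored v (x : 'rV[R]_d) t : bool :=
  [forall l : 'I_T.+1, (block K t <= l)%N ==> ~~ discovered (signs v : 'I_d -> R) (scaled kap x) l].

Lemma unexploredP v x t : reflect
  (forall l, (block K t <= l)%N -> ~~ discovered (signs v : 'I_d -> R) (scaled kap x) l)
  (unexplored v x t).
Proof.
apply: (iffP forallP) => [xt l tl|xt l]; last by apply/implyP; exact: xt.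
have [lT|lT] := ltnP l T.+1; first exact: (implyP (xt (Ordinal lT))).
by rewrite /discovered (corr_large m_gt0 _ _ lT) -ltNge invr_gt0 ltr0n.
Qed.

Definition safe v zs t : bool := [forall s : 'I_t, unexplored v (query_point v zs s) s].

Lemma safeS v zs t :
  safe v zs t.+1 = safe v zs t && unexplored v (query_point v zs t) t.
Proof.
apply/forallP/andP => [vt|[/forallP vt vt1] s].
  split; last exact: (vt ord_max).
  by apply/forallP => s; exact: (vt (widen_ord (leqnSn t) s)).
case: (unliftP ord_max s) => [s' ->|->] //.
by have := vt s'; rewrite [nat_of_ord (lift _ _)]lift_max.
Qed.

(** In a safe run, block [i] stays undiscovered up to its window. Before that window block [i.-1] is
    undiscovered too and the answers are blind to block [i], which is why products of signs and
    coins are compared in window [i] only. *)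
Lemma transcript_eq v v' zs zs' i t : (0 < i)%N -> (block K t <= i)%N ->
    (forall k : 'I_d, block m k != i -> tnth v k = tnth v' k) ->
    (forall s (k : 'I_d), (s < t)%N -> block m k != i ->
      tnth (zs s) k = tnth (zs' s) k) ->
    (forall s (k : 'I_d), (s < t)%N -> block K s = i -> block m k = i ->
      tnth v k (+) tnth (zs s) k = tnth v' k (+) tnth (zs' s) k) ->
  safe v zs t -> safe v' zs' t -> transcript v zs t = transcript v' zs' t.
Proof.
move=> i0 ti vv'; elim: t ti => [|t IHt] ti zz' vz safe1 safe2.
  by rewrite [LHS]tuple0 [RHS]tuple0.
have ti' : (block K t <= i)%N.
  by apply: leq_trans ti; rewrite /block ltnS leq_div2r.
move: safe1 safe2; rewrite !safeS => /andP[safe1 /unexploredP ux1].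
move=> /andP[safe2 /unexploredP ux2].
have E : transcript v zs t = transcript v' zs' t.
  by apply: IHt => // s k st; [apply: zz'|apply: vz]; exact: ltnW.
have ptE : query_point v zs t = query_point v' zs' t by rewrite /query_point E.
rewrite !transcriptS; apply/val_inj => /=; congr rcons; first by rewrite E.
rewrite -ptE in ux2 *; apply/rowP => k; rewrite !mxE /=; congr (_ * _).
apply: (chain_grad_local del i0).
- by move=> l li; rewrite /signs vv'.
- by move=> l li; rewrite /signs zz'.
- by move=> l il; apply: ux1; exact: leq_trans il.
- exact: ux2.
move=> disc l li; rewrite -!sg_addb vz//.
(* An earlier window would forbid the discovery of block [i.-1]. *)
apply/eqP; rewrite eqn_leq ti' /= leqNgt; apply/negP => ti1.
move: disc; apply/negP; apply: ux1.
by rewrite -ltnS prednK.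
Qed.

Definition draws (z : n.-tuple (d.-tuple bool)) s : d.-tuple bool :=
  nth [tuple false | _ < d] z s.

Lemma draws_flips i c (z : n.-tuple (d.-tuple bool)) s : (s < n)%N ->
  draws (flips K i c z) s = if block K s == i then flip i c (draws z s) else draws z s.
Proof.
move=> sn; have drawsE (y : n.-tuple (d.-tuple bool)) : draws y s = tnth y (Ordinal sn).
  by rewrite (tnth_nth [tuple false | _ < d]).
by rewrite !drawsE tnth_mktuple.
Qed.

Hypothesis delK : del ^+ 2 * K%:R <= 512^-1.

Let del01' : 0 <= del <= 1. Proof. by case/andP: del01 => /ltW -> ->. Qed.

Local Notation weight z := (sample_weight del z).
Local Notation tail := (2 ^+ d * expR (- (m%:R / 256)) : R).

Let tail_ge0 : 0 <= tail. Proof. by rewrite mulr_ge0 ?exprn_ge0 ?expR_ge0. Qed.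

Let weight_ge0 (z : n.-tuple (d.-tuple bool)) : 0 <= weight z.
Proof.
by apply: prodr_ge0 => s _; apply: prodr_ge0 => k _; exact: coin_ge0.
Qed.

Lemma sum_sample_weight : \sum_(z : n.-tuple (d.-tuple bool)) weight z = 1.
Proof.
by rewrite (sum_tuple_prod (fun=> @coins R del d)) big1// => s _; exact: sum_coins.
Qed.

(** All flips for which the event occurs produce the same transcript, hence the same point [X]: any
    one of them supplies the point, independent of [c], that [flip_average] asks for. *)
Lemma exploration_weight t i (X : t.-tuple (borel_rV R d) -> 'rV[R]_d) :
    (t <= n)%N -> (0 < i)%N -> (block K t <= i)%N ->
  \sum_v \sum_z weight z * (safe v (draws z) t && discovered (signs v : 'I_d -> R)
    (scaled kap (X (transcript v (draws z) t))) i)%:R <= tail.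
Proof.
move=> tn i0 ti; pose E v z := safe v (draws z) t &&
  discovered (signs v : 'I_d -> R) (scaled kap (X (transcript v (draws z) t))) i.
apply: (flip_average m_gt0 K_gt0 del01' (E := E) i0 delK) => v z.
have [[c0 E0]|none] := pselect (exists c, E (flip i c v) (flips K i c z)); last first.
  by exists (fun=> 0) => c Ec; exfalso; apply: none; exists c.
exists (scaled kap (X (transcript (flip i c0 v) (draws (flips K i c0 z)) t))) => c.
case/andP: E0 => safe0 _ /andP[safec]; congr (discovered _ (scaled _ (X _)) _).
apply: (transcript_eq i0 ti) => // [k ki|s k st ki|s k st si ki].
- by rewrite !tnth_mktuple (negbTE ki).
- rewrite !draws_flips ?(leq_trans st)//; case: (block K s == i) => //.
  by rewrite !tnth_mktuple (negbTE ki).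
- rewrite !draws_flips ?(leq_trans st)// si eqxx !tnth_mktuple ki eqxx /=.
  by rewrite !addbA; case: (tnth v k); case: (tnth c k); case: (tnth c0 k);
    case: (tnth (draws z s) k).
Qed.

Lemma discovery_weight t (X : t.-tuple (borel_rV R d) -> 'rV[R]_d) : (t <= n)%N ->
  \sum_v \sum_z weight z * (safe v (draws z) t &&
    ~~ unexplored v (X (transcript v (draws z) t)) t)%:R <= T%:R * tail.
Proof.
move=> tn; pose E v z i := safe v (draws z) t &&
  discovered (signs v : 'I_d -> R) (scaled kap (X (transcript v (draws z) t))) i.
have bad_le v z : (safe v (draws z) t &&
    ~~ unexplored v (X (transcript v (draws z) t)) t)%:R <=
    \sum_(i < T) ((block K t <= i.+1)%N && E v z i.+1)%:R :> R.
  have [safet|] := boolP (safe v (draws z) t); last by rewrite sumr_ge0.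
  have [|] := boolP (unexplored _ _ _); first by rewrite sumr_ge0.
  rewrite negb_forall => /existsP[[[|l] lT]]; rewrite negb_imply => /andP[tl /negPn disc].
    (* Windows are numbered from 1, so the artificial block 0, always discovered, is not at
       stake. *)
    by rewrite ltn0 in tl.
  rewrite (bigD1 (Ordinal (lT : (l < T)%N)))//= tl /E safet.
  by rewrite disc lerDl sumr_ge0.
apply: le_trans (_ : \sum_(i < T) \sum_v \sum_z
    weight z * ((block K t <= i.+1)%N && E v z i.+1)%:R <= _).
  rewrite [leRHS]exchange_big/=; apply: ler_sum => v _.
  rewrite [leRHS]exchange_big/=; apply: ler_sum => z _.
  by rewrite -mulr_sumr ler_wpM2l.
have -> : T%:R * tail = \sum_(i < T) tail by rewrite sumr_const card_ord mulr_natl.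
apply: ler_sum => i _.
have [ti|ti] := boolP (block K t <= i.+1)%N; first exact: (@exploration_weight t i.+1 X tn isT ti).
by rewrite big1// => v _; rewrite big1// => z _; rewrite mulr0.
Qed.

Lemma unsafe_weight t : (t <= n)%N ->
  \sum_v \sum_z weight z * (~~ safe v (draws z) t)%:R <= t%:R * (T%:R * tail).
Proof.
elim: t => [_|t IHt tn].
  rewrite mul0r big1// => v _; rewrite big1// => z _.
  by rewrite (_ : safe _ _ _) ?mulr0//; apply/forallP => -[].
have -> : t.+1%:R * (T%:R * tail) = t%:R * (T%:R * tail) + T%:R * tail.
  by rewrite -[t.+1%:R]natr1; ring.
apply: le_trans (lerD (IHt (ltnW tn))
  (@discovery_weight t (fun ys => query A (u, ys)) (ltnW tn))).
rewrite -big_split/=; apply: ler_sum => v _.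
rewrite -big_split/=; apply: ler_sum => z _.
rewrite -mulrDr ler_wpM2l// safeS -/(query_point _ _ _).
by case: (safe _ _ _) => /=; rewrite ?add0r ?addr0// lerDl.
Qed.

(** The output counts as one more query, at time [n], whence the factor [n.+1]. The sum over the
    signs is not normalised, whence [2 ^+ d]. *)
Lemma good_weight (X : n.-tuple (borel_rV R d) -> 'rV[R]_d) :
  2 ^+ d * (1 - n.+1%:R * T%:R * expR (- (m%:R / 256))) <=
  \sum_v \sum_z weight z * (unexplored v (X (transcript v (draws z) n)) n)%:R.
Proof.
have := lerD (unsafe_weight (leqnn n)) (discovery_weight X (leqnn n)).
have : \sum_(v : d.-tuple bool) \sum_(z : n.-tuple (d.-tuple bool)) weight z = 2 ^+ d.
  by under eq_bigr do rewrite sum_sample_weight; rewrite sumr_const card_tuple card_bool natrX.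
move=> total bad; rewrite mulrBr mulr1 lerBlDr -[leLHS]total.
apply: le_trans (_ : \sum_v \sum_z weight z *
    (unexplored v (X (transcript v (draws z) n)) n)%:R +
  (\sum_v \sum_z weight z * (~~ safe v (draws z) n)%:R +
   \sum_v \sum_z weight z * (safe v (draws z) n &&
    ~~ unexplored v (X (transcript v (draws z) n)) n)%:R) <= _).
  rewrite -!big_split/=; apply: ler_sum => v _.
  rewrite -!big_split/=; apply: ler_sum => z _.
  rewrite -!mulrDr ler_peMr//.
  by case: (unexplored _ _ _); case: (safe _ _ _) => /=; lra.
rewrite lerD2l (le_trans bad)// le_eqVlt; apply/orP; left; apply/eqP.
by rewrite -[n.+1%:R]natr1; ring.
Qed.

End transcript.

(** * The risk *)

Section risk_measurability.
Context {R : realType} {d n : nat} (A : algorithm R d n) (O : oracle R d).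
Local Notation resp := (@responses R d n A O).
Local Notation final := (@final_point R d n A O).

Lemma measurable_responses t : (t <= n)%N ->
  measurable_fun [set: seed A * t.-tuple (sample O)]
    (fun w => resp w.1 w.2).
Proof.
elim: t => [_|t IHt tn].
  by apply: measurable_cst.
pose prefix (z : t.+1.-tuple (sample O)) : t.-tuple (sample O) :=
  [tuple tnth z (widen_ord (leqnSn t) i) | i < t].
have mprefix : measurable_fun [set: t.+1.-tuple (sample O)] prefix.
  apply/measurable_fun_tnthP => i.
  rewrite (_ : _ \o _ = (@tnth _ _)^~ (widen_ord (leqnSn t) i)).
    exact: measurable_tnth.
  by apply/funext => z /=; rewrite tnth_mktuple.
have mys : measurable_fun [set: seed A * t.+1.-tuple (sample O)]
    (fun w => resp w.1 (prefix w.2)).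
  apply: (measurableT_comp (IHt (ltnW tn))
    (g := fun w : seed A * t.+1.-tuple (sample O) => (w.1, prefix w.2))).
  by apply: measurable_fun_pair => //; exact: measurableT_comp.
have mquery : measurable_fun [set: seed A * t.+1.-tuple (sample O)]
    (fun w => query A (w.1, resp w.1 (prefix w.2))).
  exact: (measurableT_comp (@measurable_query R d n A t tn)
    (measurable_fun_pair measurable_fst mys)).
have mlast : measurable_fun [set: seed A * t.+1.-tuple (sample O)]
    (fun w => tnth w.2 ord_max).
  exact: (measurableT_comp (measurable_tnth ord_max) measurable_snd).
have manswer := measurableT_comp (@measurable_answer R d O)
  (measurable_fun_pair mquery mlast).
exact: (measurableT_comp (@measurable_tsnoc _ (borel_rV R d) t)
  (measurable_fun_pair mys manswer)).
Qed.

Lemma measurable_final_point :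
  measurable_fun [set: seed A * n.-tuple (sample O)]
    (fun w => final w : borel_rV R d).
Proof.
exact: (measurableT_comp (@measurable_output R d n A)
  (measurable_fun_pair measurable_fst (measurable_responses (leqnn n)))).
Qed.

Lemma measurable_gradient_norm (F : 'rV[R]_d -> R) : continuous (gradient F) ->
  measurable_fun [set: seed A * n.-tuple (sample O)]
    (fun w => enorm (gradient F (final w))).
Proof.
move=> gradF; pose g (x : 'rV[R]_d) := enorm (gradient F x).
apply: (measurableT_comp (f := g : borel_rV R d -> R)); last exact: measurable_final_point.
apply: (measurableT_comp (f := @Num.sqrt R)).
  apply: open_continuous_measurable_fun; first exact: openT.
  by move=> x _; exact: sqrt_continuous.
apply: measurable_sum => k; apply: measurable_funX; apply: continuous_borel_R => x.
apply: (@continuous_comp _ _ _ (gradient F) (fun y : 'rV[R]_d => y 0 k)); first exact: gradF.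
exact: coord_continuous.
Qed.

End risk_measurability.

Section hard_instance_exists.
Context {R : realType}.
Variables (T m K : nat) (al kap del : R).
Hypotheses (m_gt0 : (0 < m)%N) (K_gt0 : (0 < K)%N).
Hypotheses (al_gt0 : 0 < al) (kap_gt0 : 0 < kap).
Hypothesis del01 : 0 < del <= 1.
Hypothesis delK : del ^+ 2 * K%:R <= 512^-1.
Local Notation d := (T * m)%N.
Local Notation hard_oracle := (@hard_oracle R T m al kap del m_gt0).
Local Notation hard v := (hard_fun al kap (signs v : 'I_d -> R)).
Variables (n : nat) (A : algorithm R d n) (eps : R).
Hypotheses (eps_gt0 : 0 < eps) (nTK : (n < T * K)%N).
Hypothesis amplitude : (2 * eps) * (8 * Num.sqrt m%:R) <= al * kap.
Hypothesis failure : n.+1%:R * T%:R * expR (- (m%:R / 256)) <= 16^-1 :> R.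

Local Notation Z := (d.-tuple bool).

Let del01' : 0 <= del <= 1. Proof. by case/andP: del01 => /ltW -> ->. Qed.

(** The gradient is at least [2 * eps] except with probability 1/16. The margin between 3/2 and 1
    later yields a strict inequality. *)
Lemma average_gradient_ge (u : seed A) :
  2 ^+ d * (3 / 2 * eps) <= \sum_(v : Z) \sum_(z : n.-tuple Z) sample_weight del z *
    enorm (gradient (hard v) (@final_point R d n A (hard_oracle v) (u, z))).
Proof.
have good := @good_weight R T m K al kap del m_gt0 K_gt0 del01 n A u delK
  (fun ys => output A (u, ys)).
apply: le_trans (_ : 2 * eps * \sum_(v : Z) \sum_(z : n.-tuple Z)
  sample_weight del z * (unexplored K kap v
    (output A (u, transcript al kap del m_gt0 u v (draws z) n)) n)%:R <= _).
  have e2 : 0 <= 2 * eps by rewrite mulr_ge0 ?(ltW eps_gt0).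
  apply: le_trans (ler_wpM2l e2 good); rewrite [leRHS]mulrCA ler_wpM2l ?exprn_ge0//.
  by have := ler_wpM2l (ltW eps_gt0) failure; lra.
rewrite mulr_sumr; apply: ler_sum => v _; rewrite mulr_sumr; apply: ler_sum => z _.
rewrite mulrCA ler_wpM2l//.
  by apply: prodr_ge0 => s _; apply: prodr_ge0 => k _; exact: coin_ge0.
have enorm_ge0 (y : 'rV[R]_d) : 0 <= enorm y by exact: sqrtr_ge0.
have [/unexploredP ux|_] := boolP (unexplored _ _ _ _ _); last by rewrite mulr0.
rewrite mulr1; have T0 : (0 < T)%N by case: (T) nTK.
apply: (gradient_hard_fun_large m_gt0 al_gt0 kap_gt0 (i := T)); rewrite ?T0 ?leqnn//.
  by rewrite mulr_ge0 ?(ltW eps_gt0).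
(* As [n < T * K], time [n] belongs to a window numbered at most [T], so the last block is still
   undiscovered. *)
have := ux m_gt0 T; rewrite /transcript (_ : [tuple draws z s | s < n] = z).
  by apply; rewrite /block ltn_divLR.
by apply: eq_from_tnth => s; rewrite tnth_mktuple (tnth_nth [tuple false | _ < d]).
Qed.

(** The average over the signs is bounded for each seed and then integrated, so one sign vector
    serves all seeds. Tonelli's theorem fixes the seed first, which turns the integral over the
    samples into a finite sum. *)
Lemma exists_hard_sign :
  exists v : Z, (eps%:E < stationarity_risk A (hard_oracle v) (hard v))%E.
Proof.
pose f v (w : seed A * n.-tuple Z) : R :=
  enorm (gradient (hard v) (@final_point R d n A (hard_oracle v) w)).
have f0 v w : 0 <= f v w by exact: sqrtr_ge0.
have mf v : measurable_fun [set: seed A * n.-tuple Z] (f v).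
  have [[_ cgrad] _ _ _] :=
    smooth_class_hard_fun m_gt0 al_gt0 kap_gt0 v (lexx _) (lexx _).
  exact: (@measurable_gradient_norm R d n A (hard_oracle v) _ cgrad).
pose P := iid_law (iid_law (coin_law del) d) n : probability (n.-tuple Z) R.
pose g v (u : seed A) : R := \sum_(z : n.-tuple Z) sample_weight del z * f v (u, z).
have riskE v : stationarity_risk A (hard_oracle v) (hard v) =
    (\int[seed_law A]_u (g v u)%:E)%E.
  rewrite /stationarity_risk unlock.
  have := @fubini_tonelli1 _ _ _ _ R (seed_law A) P (EFin \o f v)
    (proj2 (measurable_EFinP _ _) (mf v)) => ->.
    apply: eq_integral => u _; rewrite /fubini_F.
    have mz (x : Z) : measurable [set x] by exact: measurable_tuple_set1.
    have [|_ ->] := @finite_law_integral R _ _ P (enum {: n.-tuple Z})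
      (fun z => sample_weight del z) (fun z => f v (u, z)) (enum_uniq _) (mem_enum _)
      (measurable_tuple_set1 mz).
      move=> z; rewrite /P (iid_law_set1 mz (p := @coins R del d))// => x.
      exact: coins_law_set1.
    by rewrite big_enum.
  by move=> w; rewrite lee_fin.
have weight0 (z : n.-tuple Z) : 0 <= sample_weight del z.
  by apply: prodr_ge0 => s _; apply: prodr_ge0 => k _; exact: coin_ge0.
have g0 v u : 0 <= g v u by apply: sumr_ge0 => z _; rewrite mulr_ge0.
have mg v : measurable_fun [set: seed A] (EFin \o g v).
  apply/measurable_EFinP; apply: measurable_sum => z; apply: measurable_funM => //.
  exact: (measurableT_comp (mf v) (measurable_pair2 z)).
apply: contrapT => no_sign.
have risk_le v : (\int[seed_law A]_u (g v u)%:E <= eps%:E)%E.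
  by rewrite -riskE leNgt; apply/negP => vgt; apply: no_sign; exists v.
have : (\sum_(v : Z) \int[seed_law A]_u (g v u)%:E <= (2 ^+ d * eps)%:E)%E.
  apply: le_trans (lee_sum _ (fun v _ => risk_le v)) _.
  by rewrite sumEFin sumr_const card_tuple card_bool lee_fin -[leLHS]mulr_natl natrX.
apply/negP; rewrite -ltNge -ge0_integral_sum//; last by move=> v u _; rewrite lee_fin.
apply: (@lt_le_trans _ _ (\int[seed_law A]_u (2 ^+ d * (3 / 2 * eps))%:E)%E).
  rewrite integral_cst//= probability_setT mule1 lte_fin ltr_pM2l ?exprn_gt0//.
  by have := eps_gt0; lra.
apply: ge0_le_integral => //.
- by move=> u _; rewrite lee_fin !mulr_ge0 ?exprn_ge0// ?ltW.
- by apply: emeasurable_sum => v; exact: mg.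
by move=> u _; rewrite sumEFin lee_fin; exact: average_gradient_ge.
Qed.

End hard_instance_exists.

(** * Choice of the parameters *)

Section parameters.
Context {R : realType}.
Variables (Delta L sigma eps : R) (N : nat).
Hypotheses (Delta_gt0 : 0 < Delta) (L_gt0 : 0 < L) (sigma_gt0 : 0 < sigma).
Hypothesis eps_gt0 : 0 < eps.
Hypothesis eps_le : eps <= 2 ^- 20 * Num.min sigma (Num.sqrt (Delta * L)).

Let D : R := Delta * L / eps ^+ 2.
Let S : R := sigma ^+ 2 / eps ^+ 2.

Lemma complexity_split : Delta * L / eps ^+ 2 +
  Delta * L * sigma ^+ 2 / eps ^+ 4 = D * (1 + S).
Proof. by rewrite /D /S; field; rewrite gt_eqF. Qed.

Let eps2_gt0 : 0 < eps ^+ 2. Proof. by rewrite exprn_gt0. Qed.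

Lemma sigma_eps_ge : 2 ^+ 20 * eps <= sigma.
Proof.
rewrite -ler_pdivlMl ?exprn_gt0//; apply: le_trans eps_le _.
by rewrite ler_wpM2l ?invr_ge0 ?exprn_ge0// ge_min lexx.
Qed.

Lemma sqrt_eps_ge : 2 ^+ 20 * eps <= Num.sqrt (Delta * L).
Proof.
rewrite -ler_pdivlMl ?exprn_gt0//; apply: le_trans eps_le _.
by rewrite ler_wpM2l ?invr_ge0 ?exprn_ge0// ge_min lexx orbT.
Qed.

Let sqr_ge (x : R) : 2 ^+ 20 * eps <= x -> 2 ^+ 40 <= x ^+ 2 / eps ^+ 2.
Proof.
have eps0 : 0 <= 2 ^+ 20 * eps by rewrite mulr_ge0 ?exprn_ge0 ?(ltW eps_gt0).
move=> ex; rewrite ler_pdivlMr// (_ : 2 ^+ 40 * eps ^+ 2 = (2 ^+ 20 * eps) ^+ 2).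
  by rewrite lerXn2r ?nnegrE ?(le_trans eps0).
by rewrite exprMn -exprM.
Qed.

Lemma S_ge : 2 ^+ 40 <= S. Proof. exact: sqr_ge sigma_eps_ge. Qed.

Lemma D_ge : 2 ^+ 40 <= D.
Proof.
rewrite /D -[X in X / _]sqr_sqrtr; first exact: sqr_ge sqrt_eps_ge.
by rewrite mulr_ge0 ?ltW.
Qed.

Let T := chain_length Delta L eps.

Lemma chain_length_le : T%:R <= D / (320 * 10 ^+ 4).
Proof.
have -> : D / (320 * 10 ^+ 4) = Delta * L / (320 * 10 ^+ 4 * eps ^+ 2).
  by rewrite /D; field; rewrite gt_eqF.
by rewrite truncn_le divr_ge0 ?mulr_ge0 ?exprn_ge0 ?ler0n ?ltW.
Qed.

Lemma chain_length_ge : D / (640 * 10 ^+ 4) <= T%:R.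
Proof.
have : D / (320 * 10 ^+ 4) < T.+1%:R.
  have -> : D / (320 * 10 ^+ 4) = Delta * L / (320 * 10 ^+ 4 * eps ^+ 2).
    by rewrite /D; field; rewrite gt_eqF.
  exact: truncnS_gt.
rewrite -[T.+1%:R]natr1; have := D_ge; lra.
Qed.

Let T_gt0 : (0 < T)%N.
Proof. by rewrite -(ltr0n R); have := D_ge; have := chain_length_ge; lra. Qed.

Let M : R := Num.max (2 ^+ 15) (256 * ln (16 * (N + 1)%:R * T%:R)).
Let m := `|Num.ceil M|%N.

Let m_ge : M <= m%:R.
Proof.
by rewrite natr_absz (le_trans (ceil_ge M))// ler_int ler_norm.
Qed.

Let m_gt0 : (0 < m)%N.
Proof.
rewrite -(ltr0n R); apply: lt_le_trans m_ge.
by rewrite lt_max exprn_gt0.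
Qed.

(** The logarithm in the dimension pays for the union bound over [N.+1] points and [T] blocks. *)
Let tail_le : N.+1%:R * T%:R * expR (- (m%:R / 256)) <= 16^-1 :> R.
Proof.
have NT0 : 0 < N.+1%:R * T%:R :> R by rewrite mulr_gt0 ?ltr0n.
pose y : R := 16 * (N.+1%:R * T%:R); have y0 : 0 < y by rewrite mulr_gt0 ?ltr0n.
have : expR (- (m%:R / 256)) <= y^-1.
  rewrite -[y in leRHS](lnK y0) -expRN ler_expR lerN2 ler_pdivlMr ?ltr0n// mulrC.
  by apply: le_trans m_ge; rewrite /M /y addn1 mulrA le_max lexx orbT.
move=> /(ler_wpM2l (ltW NT0))/le_trans; apply.
by rewrite invfM mulrCA divff ?mulr1// gt_eqF.
Qed.

(** The successor makes [K] exceed [S / 2 ^+ 40], and [S_ge] keeps it within a factor 2 of this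
    value. *)
Let K := (Num.truncn (S / 2 ^+ 40)).+1.

Let K_le : K%:R <= S / 2 ^+ 39.
Proof.
have : (Num.truncn (S / 2 ^+ 40))%:R <= S / 2 ^+ 40.
  by rewrite truncn_le divr_ge0 ?exprn_ge0// (le_trans _ S_ge)// exprn_ge0.
by rewrite /K -[K%:R]natr1; have := S_ge; lra.
Qed.

Let K_gt : S / 2 ^+ 40 < K%:R. Proof. exact: truncnS_gt. Qed.

(** The factor 2^10 dominates 38 * 16, the noise constant times the 16 of [alkap]. *)
Let del : R := 2 ^+ 10 * eps / sigma.

Let del01 : 0 < del <= 1.
Proof.
rewrite /del divr_gt0 ?mulr_gt0 ?exprn_gt0//= ler_pdivrMr// mul1r.
by have := sigma_eps_ge; have := eps_gt0; lra.
Qed.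

Let delK : del ^+ 2 * K%:R <= 512^-1.
Proof.
have -> : del ^+ 2 = 2 ^+ 20 / S by rewrite /del /S; field; rewrite !gt_eqF.
have S0 : 0 < S by rewrite (lt_le_trans _ S_ge) ?exprn_gt0.
by rewrite mulrAC ler_pdivrMr//; have := K_le; lra.
Qed.

(* With these scales the gradient at a point with an undiscovered block has norm
   at least [2 eps], and its Lipschitz constant is at most
   [16 * 2 ^+ 12 * L / (2 * 10 ^+ 5)]. *)
Let lam : R := 2 * 10 ^+ 5 * eps / L.
Let al : R := 16 * eps * lam.
Let kap : R := Num.sqrt m%:R / lam.

Let lam_gt0 : 0 < lam.
Proof. by rewrite divr_gt0 ?mulr_gt0 ?exprn_gt0 ?ltr0n. Qed.

Let al_gt0 : 0 < al.
Proof. by apply: mulr_gt0 lam_gt0; rewrite mulr_gt0 ?ltr0n. Qed.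

Let kap_gt0 : 0 < kap.
Proof. by rewrite divr_gt0// sqrtr_gt0 ltr0n. Qed.

Let alkap : al * kap = 16 * eps * Num.sqrt m%:R.
Proof. by rewrite /al /kap; field; rewrite gt_eqF. Qed.

Lemma hard_algorithm_bound n (A : algorithm R (T * m) n) : (n <= N)%N ->
    N%:R <= (2560 * 10 ^+ 4 * 2 ^+ 39)^-1 *
      (Delta * L / eps ^+ 2 + Delta * L * sigma ^+ 2 / eps ^+ 4) ->
  exists (F : 'rV[R]_(T * m) -> R) (O : oracle R (T * m)),
    [/\ smooth_class Delta L F, unbiased F O, bounded_noise sigma F O &
        (eps%:E < stationarity_risk A O F)%E].
Proof.
move=> nN; rewrite complexity_split => N_le.
have nTK : (n < T * K)%N.
  rewrite (leq_ltn_trans nN)// -(ltr_nat R) natrM.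
  apply: le_lt_trans N_le _.
  have D40 := D_ge; have S40 := S_ge; have TD := chain_length_ge.
  have DS : 0 <= D * (S - 1) by rewrite mulr_ge0//; lra.
  (* Here [1 + S <= 2 * S], and 2 * 640 * 2^40 = 2560 * 2^39 is the origin of the constant in the
     statement. *)
  apply: le_lt_trans (_ : D / (640 * 10 ^+ 4) * (S / 2 ^+ 40) < _); first by lra.
  apply: le_lt_trans (_ : T%:R * (S / 2 ^+ 40) < _).
    by rewrite ler_wpM2r// divr_ge0 ?exprn_ge0//; lra.
  by rewrite ltr_pM2l ?ltr0n.
have failure : n.+1%:R * T%:R * expR (- (m%:R / 256)) <= 16^-1 :> R.
  apply: le_trans tail_le; apply: ler_wpM2r; first exact: expR_ge0.
  by apply: ler_wpM2r; [exact: ler0n|rewrite ler_nat ltnS].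
have amplitude : 2 * eps * (8 * Num.sqrt m%:R) <= al * kap by rewrite alkap; lra.
have [v risk] := @exists_hard_sign R T m K al kap del m_gt0 (ltn0Sn _) al_gt0
  kap_gt0 del01 delK n A eps eps_gt0 nTK amplitude failure.
exists (hard_fun al kap (signs v)), (hard_oracle al kap del m_gt0 v).
split; last exact: risk.
- apply: (smooth_class_hard_fun m_gt0 al_gt0 kap_gt0).
    (* Since [al] equals 320 * 10^4 * eps^2 / L, the middle term is exactly [Delta]. *)
    apply: le_trans (_ : al * (D / (320 * 10 ^+ 4)) <= _).
      by apply: ler_wpM2l (ltW al_gt0) _ _ _; exact: chain_length_le.
    rewrite le_eqVlt; apply/orP; left; apply/eqP.
    by rewrite /al /lam /D; field; rewrite !gt_eqF.
  have -> : al * kap / m%:R * kap = 16 * eps / lam.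
    have m0 : 0 < Num.sqrt m%:R :> R by rewrite sqrtr_gt0 ltr0n.
    rewrite alkap /kap -[X in _ / X * _]sqr_sqrtr ?ler0n//.
    by field; rewrite !gt_eqF.
  have -> : 16 * eps / lam = 16 * L / (2 * 10 ^+ 5).
    by rewrite /lam; field; rewrite !gt_eqF.
  by have := L_gt0; lra.
- exact: (unbiased_hard_oracle al kap m_gt0 del01 v).
- apply: (bounded_noise_hard_oracle m_gt0 al_gt0 kap_gt0 del01).
  rewrite alkap /del.
  have -> : sigma * (2 ^+ 10 * eps / sigma * Num.sqrt m%:R) =
      2 ^+ 10 * eps * Num.sqrt m%:R by field; rewrite gt_eqF.
  by have : 0 <= eps * Num.sqrt m%:R by [rewrite mulr_ge0 ?sqrtr_ge0 ?ltW|]; lra.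
Qed.

End parameters.

Theorem theorem4p1 (R : realType) :
  (forall (Delta L sigma eps : R) (N : nat),
    0 < Delta -> 0 < L -> 0 < sigma ->
    0 < eps -> eps <= 2 ^- 20 * Num.min sigma (Num.sqrt (Delta * L)) ->
    (0 < N)%N ->
    N%:R <= (2560 * 10 ^+ 4 * 2 ^+ 39)^-1 *
      (Delta * L / eps ^+ 2 + Delta * L * sigma ^+ 2 / eps ^+ 4) ->
    forall (n : nat) (A : algorithm R (hard_dim Delta L eps N) n),
      (n <= N)%N ->
      exists (F : 'rV[R]_(hard_dim Delta L eps N) -> R)
             (O : oracle R (hard_dim Delta L eps N)),
        [/\ smooth_class Delta L F, unbiased F O, bounded_noise sigma F O &
            (eps%:E < stationarity_risk A O F)%E]) /\
  (exists C : R, 0 < C /\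
    forall Delta L sigma eps : R,
      0 < Delta -> 0 < L -> 0 < sigma ->
      0 < eps -> eps <= 2 ^- 20 * Num.min sigma (Num.sqrt (Delta * L)) ->
      ((C * (Delta * L / eps ^+ 2 + Delta * L * sigma ^+ 2 / eps ^+ 4))%:E
        <= minimax_complexity Delta L sigma eps)%E).
Proof.
have fixed (Delta L sigma eps : R) (N : nat) :
    0 < Delta -> 0 < L -> 0 < sigma ->
    0 < eps -> eps <= 2 ^- 20 * Num.min sigma (Num.sqrt (Delta * L)) ->
    N%:R <= (2560 * 10 ^+ 4 * 2 ^+ 39)^-1 *
      (Delta * L / eps ^+ 2 + Delta * L * sigma ^+ 2 / eps ^+ 4) ->
    forall (n : nat) (A : algorithm R (hard_dim Delta L eps N) n),
      (n <= N)%N ->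
      exists (F : 'rV[R]_(hard_dim Delta L eps N) -> R)
             (O : oracle R (hard_dim Delta L eps N)),
        [/\ smooth_class Delta L F, unbiased F O, bounded_noise sigma F O &
            (eps%:E < stationarity_risk A O F)%E].
  move=> D0 L0 s0 e0 e1 NQ n A nN.
  exact: (hard_algorithm_bound D0 L0 s0 e0 e1 A nN NQ).
split=> [Delta L sigma eps N D0 L0 s0 e0 e1 _|]; first exact: fixed.
exists (2560 * 10 ^+ 4 * 2 ^+ 39)^-1; split.
  by rewrite invr_gt0 !mulr_gt0 ?exprn_gt0 ?ltr0n.
move=> Delta L sigma eps D0 L0 s0 e0 e1; apply: le_ereal_inf_tmp => _ [N [A Aeps] <-].
rewrite lee_fin leNgt; apply/negP => NQ.
(* A zero-query algorithm is covered by the bound for one query. *)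
have N1Q : (maxn N 1)%:R <= (2560 * 10 ^+ 4 * 2 ^+ 39)^-1 *
    (Delta * L / eps ^+ 2 + Delta * L * sigma ^+ 2 / eps ^+ 4).
  have [N1|N0] := leqP 1 N; first exact: ltW.
  rewrite ler_pdivlMl ?mulr1; last first.
    by rewrite !mulr_gt0 ?exprn_gt0 ?ltr0n.
  rewrite complexity_split//.
  have := D_ge D0 L0 e0 e1.
  have := S_ge e0 e1.
  move: (Delta * L / _) (sigma ^+ 2 / _) => D S S40 D40.
  have : 2 ^+ 40 * 2 ^+ 40 <= D * S by rewrite ler_pM ?exprn_ge0.
  lra.
have [F [Or [FS FU FB]]] :=
  fixed _ _ _ _ _ D0 L0 s0 e0 e1 N1Q N (A _) (leq_maxl _ _).
apply/negP; rewrite -leNgt; apply: le_trans Aeps.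
by apply: ereal_sup_ubound; exists (hard_dim Delta L eps (maxn N 1)), F, Or.
Qed.
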